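(* Let $K$ be a $1$-reduced simplicial set. The Alexander-Whitney cobar diagonal $\psi_K$ is equal to Baues's coproduct on $\Omega C(K)$: $\psi_K=\widetilde\psi$, where $\widetilde\psi:\Omega C(K)\to\Omega C(K)\otimes\Omega C(K)$ is the algebra map given, for each nondegenerate $n$-simplex $x$ of $K$ with $n\ge 2$, by $$\widetilde\psi(s^{-1}x)=\sum_{\substack{0\le m<n\\0<a_1<\cdots<a_m<n}}(-1)^{\ell(\mathbf a)}\,s^{-1}x_{0\dots a_1}\,s^{-1}x_{a_1\dots a_2}\cdots s^{-1}x_{a_m\dots n}\otimes s^{-1}x_{0a_1\dots a_mn},$$ $$\ell(\mathbf a)=(a_1-1)+\Bigl(\sum_{i=2}^m(i-1)(a_i-a_{i-1}-1)\Bigr)+m(n-a_m-1),$$ with $\ell=0$ for $m=0$ (that term being $s^{-1}x\otimes s^{-1}x_{0n}$), and with the convention that $s^{-1}$ of a face of $x$ of dimension $1$ is to be read as the unit $1$.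
   Context: A simplicial set is $1$-reduced if it has exactly one $0$-simplex and its only $1$-simplex is the degenerate one. $C(K)$ is the normalized integral chain complex of $K$. For $x\in K_n$ and $0\le a_0<\dots<a_p\le n$, $x_{a_0\dots a_p}\in K_p$ is the face of $x$ with vertices $a_0,\dots,a_p$; $x_{a\dots b}$ means all vertices from $a$ to $b$. The Koszul sign convention is used throughout. Eilenberg-Zilber data. For simplicial sets $K,L$ define $f_{K,L}:C(K\times L)\to C(K)\otimes C(L)$ by $f_{K,L}(x,y)=\sum_{i=0}^n x_{0\dots i}\otimes y_{i\dots n}$ for $(x,y)\in K_n\times L_n$, and $\nabla_{K,L}:C(K)\otimes C(L)\to C(K\times L)$ by $\nabla_{K,L}(x\otimes y)=\sum_{(\mu,\nu)}(-1)^{\mathrm{sgn}(\mu)}(s_{\nu_q}\cdots s_{\nu_1}x,\,s_{\mu_p}\cdots s_{\mu_1}y)$ for $x\in K_p$, $y\in L_q$, the sum being over all $(p,q)$-shuffles $(\mu,\nu)$ of $\{0,\dots,p+q-1\}$ and $(-1)^{\mathrm{sgn}(\mu)}$ the sign of the shuffle. The chain homotopy $\varphi_{K,L}:C(K\times L)\to C(K\times L)$ of degree $+1$ is defined as follows. For a monotone map $\alpha:[0,p]\to[0,n]$ let $\alpha':[0,p+1]\to[0,n+1]$ be $\alpha'(0)=0$, $\alpha'(j+1)=\alpha(j)+1$ (so that the derived operator of $s_j$ is $s_{j+1}$ and that of $\partial_j$ is $\partial_{j+1}$), and extend the prime termwise to integer combinations of pairs of simplicial operators acting on pairs $(x,y)$.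 With $g_n$ the degree $n$ part of $\nabla_{K,L}f_{K,L}$, put $\varphi_0=0$ and $\varphi_n=(g_n)'s_0-(\varphi_{n-1})'$. Then $f\nabla=1$, $d\varphi+\varphi d=\nabla f-1$, $\varphi\nabla=0$, $f\varphi=0$, $\varphi^2=0$. The coproduct of the chain coalgebra $C(K)$ is $f_{K,K}\circ(\Delta_K)_\sharp$, where $\Delta_K:K\to K\times K$ is the diagonal and $(\cdot)_\sharp$ denotes induced maps on normalized chains; $C(K)\otimes C(L)$ carries the tensor product coproduct. Cobar construction. For a simply-connected chain coalgebra $(C,d)$ with reduced coproduct $\overline\Delta$, $\Omega C$ is the tensor algebra $T(s^{-1}C_+)$ ($C_+=C_{>0}$, $s^{-1}$ desuspension) with the derivation differential given on generators by $d_\Omega=-s^{-1}ds+(s^{-1}\otimes s^{-1})\overline\Delta s$. A coalgebra map induces a chain algebra map of cobar constructions, denoted $\Omega(\cdot)$. The map $\widetilde\Omega f_{K,L}$. For $1$-reduced $K,L$, let $F_1=f_{K,L}$ and recursively $F_k=-\sum_{i+j=k}(F_i\otimes F_j)\Delta_{C(K\times L)}\varphi_{K,L}:C(K\times L)\to (C(K)\otimes C(L))^{\otimes k}$, where $\Delta_{C(K\times L)}$ is the coproduct of $C(K\times L)$. Then $\widetilde\Omega f_{K,L}:\Omega C(K\times L)\to\Omega(C(K)\otimes C(L))$ is the chain algebra map given on generators by $\sum_{k\ge1}(s^{-1})^{\otimes k}F_ks$ (with $s^{-1}$ of degree-$0$ elements set to $0$). Milgram's map. $q:\Omega(C\otimes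 C')\to\Omega C\otimes\Omega C'$ is the chain algebra map with $q(s^{-1}(x\otimes1))=s^{-1}x\otimes1$, $q(s^{-1}(1\otimes y))=1\otimes s^{-1}y$, $q(s^{-1}(x\otimes y))=0$ for $x\in C_+$, $y\in C'_+$. Alexander-Whitney cobar diagonal. For $K$ $1$-reduced, $\psi_K=q\circ\widetilde\Omega f_{K,K}\circ\Omega(\Delta_K)_\sharp:\Omega C(K)\to\Omega C(K)\otimes\Omega C(K)$.
   Formalization: The summand (a_1-1) is dropped from ℓ(a) (with it the identity fails for n=3 and ψ̃ is not a chain map for n=4), and each term (F_i⊗F_j)Δφ in the recursion for F_k carries the extra sign (-1)^{j(i-1)}, needed for Ω̃f to be a chain map. *)

(* Defs.v *)
From HB Require Import structures.
From mathcomp Require Import all_boot all_order all_algebra.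
From mathcomp Require Import finmap.
From mathcomp Require Import boolp.
From mathcomp.multinomials Require Import monalg.

Set Implicit Arguments.
Unset Strict Implicit.
Unset Printing Implicit Defensive.

Import GRing.Theory.
Local Open Scope ring_scope.

Definition ksign (n : nat) : int := (-1) ^+ n.

Lemma ksignD m n : ksign (m + n) = ksign m * ksign n.
Proof. exact: exprD. Qed.

(** * Free abelian groups [{malg int[B]}] and linear extension *)

HB.lock Definition lext (B : choiceType) (V : zmodType) (h : B -> V)
  (c : {malg int[B]}) : V := \sum_(b <- msupp c) h b *~ c@_b.

Section LinearExtension.
Variables (B : choiceType) (V : zmodType) (h : B -> V).

Local Notation lext := (lext h).

Lemma lextE c : lext c = \sum_(b <- msupp c) h b *~ c@_b.
Proof. by rewrite unlock. Qed.

Lemma lextEw (d : {fset B}) c :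
  (msupp c `<=` d)%fset -> lext c = \sum_(b <- d) h b *~ c@_b.
Proof.
move=> le; rewrite lextE (big_fset_incl _ le) // => b _ /mcoeff_outdom ->.
by rewrite mulr0z.
Qed.

Lemma lext_is_additive : additive lext.
Proof.
move=> c e; pose d := (msupp c `|` msupp e)%fset.
rewrite (@lextEw d) ?(@lextEw d c) ?(@lextEw d e) ?fsubsetUl ?fsubsetUr //;
  last exact: msuppB_le.
by rewrite -sumrB; apply: eq_bigr => b _; rewrite mcoeffB mulrzBr.
Qed.

HB.instance Definition _ :=
  GRing.isZmodMorphism.Build {malg int[B]} V lext lext_is_additive.

Lemma lextU b : lext << b >> = h b.
Proof. by rewrite lextE msuppU oner_eq0 big_seq_fset1 mcoeffUU mulr1z. Qed.

Lemma lextUz n b : lext << n *g b >> = h b *~ n.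
Proof.
by rewrite (@lextEw [fset b]%fset) ?msuppU_le // big_seq_fset1 mcoeffUU.
Qed.

End LinearExtension.

Lemma lext_ext (B : choiceType) (V : zmodType) (f g : {additive {malg int[B]} -> V}) :
  (forall b, f << b >> = g << b >>) -> f =1 g.
Proof.
move=> e c; rewrite [c]monalgE !raddf_sum; apply: eq_bigr => b _.
by rewrite -[c@_b]intz (raddfMz (mkmalgU b)) !raddfMz e.
Qed.

Lemma eq_lext (B : choiceType) (V : zmodType) (f g : B -> V) :
  f =1 g -> lext f =1 lext g.
Proof. by move=> e c; rewrite !lextE; apply: eq_bigr => b _; rewrite e. Qed.

(** A graded free abelian group is given by a homogeneous basis. *)

Record gbasis := GBasis { gcarrier :> choiceType; gdeg : gcarrier -> nat }.

Definition gtens (B B' : gbasis) : gbasis :=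
  @GBasis (B * B')%type (fun b => (gdeg b.1 + gdeg b.2)%N).

Definition tens (A B : choiceType) (x : {malg int[A]}) (y : {malg int[B]}) :
  {malg int[(A * B)%type]} :=
  lext (fun a => lext (fun b => << (a, b) >>) y) x.

(** * The tensor algebras [T(C)] and [T(s^-1 C_+)] *)

(** [T(C)] has the words in the basis of [C] as basis; the tensor product of
    words is their concatenation, i.e. the product of [{malg int[{fmonom B}]}].
    The summand [C^{(x)k}] is spanned by the words of length [k]. *)
Notation tensalg B := {malg int[{fmonom B}]}.

Section Cobar.
Variable B : gbasis.

Definition gen := {b : B | (0 < gdeg b)%N}.
HB.instance Definition _ := Choice.on gen.

Definition wdeg (w : {fmonom gen}) : nat := (\sum_(b <- w) (gdeg (val b)).-1)%N.

(** Underlying graded algebra of the cobar construction. *)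
Definition cobar := tensalg gen.
HB.instance Definition _ := GRing.Ring.on cobar.

Definition desusp_gen (b : B) : cobar :=
  if insub b is Some g then << fmu g >> else 0.

Definition desusp : {malg int[B]} -> cobar := lext desusp_gen.

(** [(s^-1)^{(x)k}] on a word [c_1 ... c_k], with the Koszul sign: the last
    [k - 1] factors [s^-1] pass [c_1], and so on. *)
Fixpoint desusp_word (w : seq B) : cobar :=
  if w is c :: w' then
    (desusp_gen c * desusp_word w') *~ ksign (size w' * gdeg c)%N
  else 1.

Definition desusp_tens : tensalg B -> cobar := lext (fun w : {fmonom B} => desusp_word w).

(** The algebra map out of the cobar construction with given values on the
    generators. *)
Definition cobar_ext (R : nzRingType) (h : gen -> R) : cobar -> R :=
  lext (fun w : {fmonom gen} => \prod_(b <- (w : seq gen)) h b).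

Section CobarExt.
Variables (R : nzRingType) (h : gen -> R).

Lemma cobar_ext_is_multiplicative : multiplicative (cobar_ext h).
Proof.
split=> [x y|]; last by rewrite /cobar_ext lextU fm1 big_nil.
rewrite /cobar_ext malgME raddf_sum !lextE mulr_suml; apply: eq_bigr => v _.
rewrite raddf_sum mulr_sumr; apply: eq_bigr => w _.
rewrite /= lextUz fmM big_cat /= mulrzAl mulrzAr -mulrzA.
by rewrite [y@_w * _]mulrC.
Qed.

HB.instance Definition _ := GRing.Additive.copy (cobar_ext h)
  (lext (fun w : {fmonom gen} => \prod_(b <- (w : seq gen)) h b)).
HB.instance Definition _ :=
  GRing.isMultiplicative.Build cobar R (cobar_ext h) cobar_ext_is_multiplicative.

Lemma cobar_ext_gen b : cobar_ext h << fmu b >> = h b.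
Proof. by rewrite /cobar_ext lextU fmU big_seq1. Qed.

End CobarExt.

End Cobar.

(** The graded tensor product of two cobar constructions, with
    (v (x) w)(v' (x) w') = (-1)^{|w||v'|} vv' (x) ww'. *)
Section KoszulTensor.
Variables B B' : gbasis.

Local Notation W := ({fmonom gen B} * {fmonom gen B'})%type.
Definition cobar2 := {malg int[W]}.
HB.instance Definition _ := GRing.Zmodule.on cobar2.

Definition kmon (p q : W) : cobar2 :=
  << (mmul p.1 q.1, mmul p.2 q.2) >> *~ ksign (wdeg p.2 * wdeg q.1)%N.

Definition kmul (x y : cobar2) : cobar2 :=
  lext (fun p => lext (kmon p) y) x.

Definition kone : cobar2 := << (mone, mone) >>.

Lemma kmulBl z : additive (kmul^~ z).
Proof. by move=> x y; rewrite /kmul raddfB. Qed.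

Lemma kmulBr z : additive (kmul z).
Proof.
have kmulE x : kmul z x = \sum_(p <- msupp z) lext (kmon p) x *~ z@_p.
  by rewrite /kmul lextE.
move=> x y; rewrite !kmulE -sumrB; apply: eq_bigr => p _.
by rewrite raddfB mulrzBl.
Qed.

Lemma kmulUU p q : kmul << p >> << q >> = kmon p q.
Proof. by rewrite /kmul !lextU. Qed.

Lemma wdegM (C : gbasis) (v w : {fmonom gen C}) :
  wdeg (mmul v w) = (wdeg v + wdeg w)%N.
Proof. by rewrite /wdeg fmM big_cat. Qed.

Lemma wdeg1 (C : gbasis) : wdeg (mone : {fmonom gen C}) = 0%N.
Proof. by rewrite /wdeg fm1 big_nil. Qed.

(* For an abstract product: conversion problems on [kmul] itself are slow. *)
Lemma kmul_assoc (K : cobar2 -> cobar2 -> cobar2) :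
    (forall z, additive (K^~ z)) -> (forall z, additive (K z)) ->
    (forall p q, K << p >> << q >> = kmon p q) -> associative K.
Proof.
move=> KBl KBr KUU.
pose mulL z : {additive cobar2 -> cobar2} :=
  HB.pack (K z) (GRing.isZmodMorphism.Build cobar2 cobar2 (K z) (KBr z)).
pose mulR z : {additive cobar2 -> cobar2} :=
  HB.pack (K^~ z) (GRing.isZmodMorphism.Build cobar2 cobar2 (K^~ z) (KBl z)).
move=> x y z; move: x.
apply: (lext_ext (f := mulR (K y z)) (g := mulR z \o mulR y)) => p /=.
move: y; apply: (lext_ext (f := mulL << p >> \o mulR z)
  (g := mulR z \o mulL << p >>)) => q /=.
move: z; apply: (lext_ext (f := mulL << p >> \o mulL << q >>)
  (g := mulL (K << p >> << q >>))) => r /=.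
have Kl q' r' : K << p >> (kmon q' r') =
    kmon p (mmul q'.1 r'.1, mmul q'.2 r'.2) *~ ksign (wdeg q'.2 * wdeg r'.1).
  by apply: etrans (raddfMz (mulL << p >>) _ _) _; rewrite /= KUU.
have Kr p' q' : K (kmon p' q') << r >> =
    kmon (mmul p'.1 q'.1, mmul p'.2 q'.2) r *~ ksign (wdeg p'.2 * wdeg q'.1).
  by apply: etrans (raddfMz (mulR << r >>) _ _) _; rewrite /= KUU.
apply: (etrans (etrans (congr1 (K << p >>) (KUU q r)) (Kl q r))).
apply: esym; apply: (etrans (etrans (congr1 (K^~ << r >>) (KUU p q)) (Kr p q))).
apply: etrans (esym (mulrzA _ _ _)) (etrans _ (mulrzA _ _ _)) => /=.
have E (w w' : W) (m n : int) :
    w = w' -> m = n -> << w >> *~ m = << w' >> *~ n :> cobar2 by move=> -> ->.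
apply: E; first by rewrite !mulmA.
rewrite -!ksignD !wdegM mulnDl mulnDr; congr ksign.
by rewrite addnC addnA.
Qed.

Lemma kmul1l : left_id kone kmul.
Proof.
move=> x; rewrite /kmul lextU.
move: x; apply: (lext_ext (g := idfun)) => q /=.
by rewrite lextU /kmon /= wdeg1 mul0n mulr1z !mul1m -surjective_pairing.
Qed.

Lemma kmul1r : right_id kone kmul.
Proof.
move=> x; rewrite /kmul.
rewrite (eq_lext (g := fun p => << p >>)); last first.
  move=> p; rewrite lextU /kmon /= wdeg1 muln0 mulr1z !mulm1.
  by rewrite -surjective_pairing.
by move: x; apply: (lext_ext (g := idfun)) => q /=; rewrite lextU.
Qed.

Lemma kmulDl : left_distributive kmul +%R.
Proof. by move=> x y z; rewrite /kmul raddfD. Qed.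

Lemma kmulDr : right_distributive kmul +%R.
Proof.
have kmulE z x : kmul z x = \sum_(p <- msupp z) lext (kmon p) x *~ z@_p.
  by rewrite /kmul lextE.
move=> z x y; rewrite !kmulE -big_split; apply: eq_bigr => p _.
by rewrite raddfD mulrzDl.
Qed.

Lemma kone_neq0 : kone != 0.
Proof. by rewrite monalgU_eq0 oner_neq0. Qed.

HB.instance Definition _ := GRing.Zmodule_isNzRing.Build cobar2
  (kmul_assoc kmulBl kmulBr kmulUU) kmul1l kmul1r kmulDl kmulDr kone_neq0.

End KoszulTensor.

(** * Simplicial sets *)

(** Monotone maps [[0,p] -> [0,n]]. *)
Definition monotone p n (h : {ffun 'I_p.+1 -> 'I_n.+1}) : bool :=
  [forall i : 'I_p.+1, forall j : 'I_p.+1, (i <= j)%N ==> (h i <= h j)%N].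

Record mon p n := Mon {
  mon_val :> {ffun 'I_p.+1 -> 'I_n.+1};
  _ : monotone mon_val }.

HB.instance Definition _ p n := [isSub for @mon_val p n].
HB.instance Definition _ p n := [Choice of mon p n by <:].

Lemma monP p n (h : mon p n) (i j : 'I_p.+1) : (i <= j)%N -> (h i <= h j)%N.
Proof. by case: h => h /= /forallP/(_ i)/forallP/(_ j)/implyP. Qed.

Lemma mon_comp_proof p n q (a : mon p n) (b : mon q p) :
  monotone [ffun i => a (b i)].
Proof.
apply/forallP => i; apply/forallP => j; apply/implyP => ij.
by rewrite !ffunE; do 2!apply: monP.
Qed.

Definition mon_comp p n q (a : mon p n) (b : mon q p) : mon q n :=
  Mon (mon_comp_proof a b).

Lemma mon_id_proof n : monotone [ffun i : 'I_n.+1 => i].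
Proof.
by apply/forallP => i; apply/forallP => j; apply/implyP; rewrite !ffunE.
Qed.

Definition mon_id n : mon n n := Mon (mon_id_proof n).

Lemma mon_cst_proof p n : monotone [ffun _ : 'I_p.+1 => ord0 : 'I_n.+1].
Proof.
by apply/forallP => i; apply/forallP => j; rewrite !ffunE leqnn implybT.
Qed.

(** The monotone map given on [0, ..., p] by [h]; [h] has to be monotone with
    values at most [n] there, see [mon_ofE]. *)
Definition mon_of p n (h : nat -> nat) : mon p n :=
  insubd (Mon (mon_cst_proof p n)) [ffun j : 'I_p.+1 => inord (h j)].

Lemma mon_ofE p n (h : nat -> nat) (j : 'I_p.+1) :
  (forall i, i <= p -> h i <= n)%N ->
  (forall i k, i <= k <= p -> h i <= h k)%N ->
  mon_of p n h j = h j :> nat.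
Proof.
move=> hn hm; rewrite /mon_of val_insubd ifT ?ffunE ?inordK ?ltnS ?hn //.
  by rewrite -ltnS.
apply/forallP => i; apply/forallP => k; apply/implyP => ik.
have [ip kp] : (i <= p /\ k <= p)%N by split; rewrite -ltnS.
by rewrite !ffunE !inordK ?ltnS ?hn // hm // ik.
Qed.

(** A simplicial set is a presheaf on the category of the sets [[0,n]];
    [act a x] is [a^* x]. *)
Record sset := SSet {
  simp :> nat -> Type;
  act : forall p n, mon p n -> simp n -> simp p;
  act_id : forall n (x : simp n), act (mon_id n) x = x;
  act_comp : forall p n q (a : mon p n) (b : mon q p) (x : simp n),
    act (mon_comp a b) x = act b (act a x) }.

Record smap (K L : sset) := SMap {
  smap_fun :> forall n, K n -> L n;
  smap_nat : forall p n (a : mon p n) (x : K n),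
    smap_fun (act a x) = act a (smap_fun x) }.

Section Product.
Variables K L : sset.

Definition sprod_act p n (a : mon p n) (x : K n * L n) : K p * L p :=
  (act a x.1, act a x.2).

Lemma sprod_act_id n (x : K n * L n) : sprod_act (mon_id n) x = x.
Proof. by case: x => x y; rewrite /sprod_act /= !act_id. Qed.

Lemma sprod_act_comp p n q (a : mon p n) (b : mon q p) (x : K n * L n) :
  sprod_act (mon_comp a b) x = sprod_act b (sprod_act a x).
Proof. by rewrite /sprod_act !act_comp. Qed.

Definition sprod : sset :=
  @SSet (fun n => (K n * L n)%type) sprod_act sprod_act_id sprod_act_comp.

End Product.

Definition sdiag (K : sset) : smap K (sprod K K) :=
  @SMap K (sprod K K) (fun n x => (x, x)) (fun p n a x => erefl).

(** The degeneracy [s_i] is the action of [sigma n i], which takes the value [i]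
    at [i] and [i + 1]. *)
Definition sigma n (i : nat) : mon n.+1 n := mon_of n.+1 n (unbump i).

(** The front and back faces [x_{0..i}] and [x_{i..n}]. *)
Definition front i n : mon i n := mon_of i n id.
Definition back i n : mon (n - i) n := mon_of (n - i) n (addn i).

Definition one_reduced (K : sset) : Prop :=
  exists v : K 0%N, (forall w : K 0%N, w = v) /\
                    (forall e : K 1%N, e = act (sigma 0 0) v).

(** ** Normalized chains *)

Definition simplex (K : sset) := {n : nat & K n}.
HB.instance Definition _ K := gen_eqMixin (simplex K).
HB.instance Definition _ K := gen_choiceMixin (simplex K).

Definition degenerate (K : sset) (u : simplex K) : Prop :=
  exists n (i : 'I_n.+1) (y : K n), u = existT _ n.+1 (act (sigma n i) y).

(** The normalized chain complex is free on the nondegenerate simplices. *)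
Definition cell (K : sset) := {u : simplex K | ~~ `[< degenerate u >]}.
HB.instance Definition _ K := Choice.on (cell K).

Definition chains (K : sset) : gbasis :=
  @GBasis (cell K) (fun c => projT1 (val c)).

Notation chain K := {malg int[chains K]}.
Notation chain2 K L := {malg int[gtens (chains K) (chains L)]}.

(** The class of a simplex, zero for degenerate simplices. *)
Definition cl (K : sset) n (x : K n) : chain K :=
  if insub (existT _ n x : simplex K) is Some c then << (c : cell K) >> else 0.

Definition chain_map (K L : sset) (h : smap K L) : chain K -> chain L :=
  lext (fun c : cell K => cl (h _ (projT2 (val c)))).

(** * Eilenberg-Zilber data *)

Definition AW_cell (K L : sset) (c : cell (sprod K L)) : chain2 K L :=
  let n := projT1 (val c) in
  let x : K n := (projT2 (val c)).1 in
  let y : L n := (projT2 (val c)).2 in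
  \sum_(i < n.+1) tens (cl (act (front i n) x)) (cl (act (back i n) y)).

Definition AW (K L : sset) : chain (sprod K L) -> chain2 K L :=
  lext (@AW_cell K L).

(** Integer combinations of pairs of simplicial operators. *)
Notation op2 p n := (mon p n * mon p n)%type.
Notation op2sum p n := {malg int[op2 p n]}.

(** A (p,q)-shuffle (mu, nu) with p + q = n is the set A of the values of mu, nu
    enumerating the complement of A.  The operator s_{nu_q} ... s_{nu_1} is the
    action of the monotone map [0,n] -> [0,p] collapsing the steps from [j] to
    [j + 1] with [j] in [~: A]; that of s_{mu_p} ... s_{mu_1} is obtained by
    exchanging [A] and [~: A]. *)
Definition shuffle_mon n p (A : {set 'I_n}) : mon n p :=
  mon_of n p (fun j => #|[set a in A | (a < j)%N]|).

(** The number of inversions of (mu_1, ..., mu_p, nu_1, ..., nu_q). *)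
Definition shuffle_inv n (A : {set 'I_n}) : nat :=
  #|[set ab : 'I_n * 'I_n | [&& ab.1 \in A, ab.2 \notin A & (ab.2 < ab.1)%N]]|.

(** The degree [n] part of nabla o f. *)
Definition nablaf n : op2sum n n :=
  \sum_(i < n.+1) \sum_(A : {set 'I_n} | #|A| == i)
    << (mon_comp (front i n) (shuffle_mon i A),
        mon_comp (back i n) (shuffle_mon (n - i) (~: A))) >>
      *~ ksign (shuffle_inv A).

Definition prime p n (a : mon p n) : mon p.+1 n.+1 :=
  mon_of p.+1 n.+1 (fun j => if j is j'.+1 then (a (inord j')).+1 else 0%N).

Definition prime_op p n : op2sum p n -> op2sum p.+1 n.+1 :=
  lext (fun ab : op2 p n => << (prime ab.1, prime ab.2) >>).

(** Composition with s_0, which is applied first. *)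
Definition comp_s0 p n : op2sum p n.+1 -> op2sum p n :=
  lext (fun ab : op2 p n.+1 =>
    << (mon_comp (sigma n 0) ab.1, mon_comp (sigma n 0) ab.2) >>).

Fixpoint phi_op n : op2sum n.+1 n :=
  match n with
  | 0 => 0
  | n'.+1 => comp_s0 (prime_op (nablaf n'.+1)) - prime_op (phi_op n')
  end.

Definition EZphi_cell (K L : sset) (c : cell (sprod K L)) : chain (sprod K L) :=
  let n := projT1 (val c) in
  let x : K n := (projT2 (val c)).1 in
  let y : L n := (projT2 (val c)).2 in
  lext (fun ab : op2 n.+1 n =>
    cl ((act ab.1 x, act ab.2 y) : sprod K L n.+1)) (phi_op n).

Definition EZphi (K L : sset) : chain (sprod K L) -> chain (sprod K L) :=
  lext (@EZphi_cell K L).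

Definition coprod (K : sset) : chain K -> chain2 K K :=
  fun c => AW (chain_map (sdiag K) c).

(** * The Alexander-Whitney cobar diagonal *)

Definition cobar_map (B B' : gbasis) (h : {malg int[B]} -> {malg int[B']}) :
  cobar B -> cobar B' :=
  cobar_ext (fun b : gen B => desusp (h << val b >>)).

Section OmegaTilde.
Variables K L : sset.
Let KL := sprod K L.
Let T := tensalg (gtens (chains K) (chains L)).

(** [F (x) G] for [G] of degree [d], followed by concatenation. *)
Definition tens_maps (d : nat) (F G : chains KL -> T) : chain2 KL KL -> T :=
  lext (fun ab : gtens (chains KL) (chains KL) =>
    (F ab.1 * G ab.2) *~ ksign (d * gdeg ab.1)%N).

(** - sum_{i+j=k} (F_i (x) F_j) Delta phi, where F_i has degree [i - 1].  The sign
    [ksign (d * _)] in [tens_maps] is the Koszul sign for evaluating F_i (x) F_j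
    on a tensor, and [ksign (j * i.-1)] is the one for (s^-1)^{(x)j} to pass F_i:
    the recursion holds between the desuspended maps (s^-1)^{(x)k} F_k.  Without
    the latter sign the algebra map [omega_tilde] would not commute with the
    cobar differentials. *)
Definition Fstep (F : nat -> chains KL -> T) (k : nat) (c : chains KL) : T :=
  - \sum_(1 <= i < k)
      tens_maps (k - i).-1 (F i) (F (k - i)%N) (coprod (EZphi << c >>))
        *~ ksign ((k - i) * i.-1)%N.

Definition F1 (c : chains KL) : T :=
  lext (fun b : gtens (chains K) (chains L) => << fmu b >>) (AW << c >>).

(* [N] is fuel. *)
Fixpoint Frec (N k : nat) (c : chains KL) : T :=
  if N is N'.+1 then if k == 1%N then F1 c else Fstep (Frec N') k c else 0.

Definition Fk (k : nat) : chains KL -> T := Frec k k.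

Lemma eq_Fstep F G k c :
  (forall i, (0 < i < k)%N -> F i =1 G i) -> Fstep F k c = Fstep G k c.
Proof.
move=> FG; have E i : (1 <= i < k)%N ->
    tens_maps (k - i).-1 (F i) (F (k - i)%N) =1
    tens_maps (k - i).-1 (G i) (G (k - i)%N).
  move=> /andP[i0 ik]; apply: eq_lext => ab.
  have -> : F i ab.1 = G i ab.1 by apply: FG; rewrite i0.
  have -> // : F (k - i)%N ab.2 = G (k - i)%N ab.2.
  by apply: FG; rewrite subn_gt0 ik ltn_subrL i0 (leq_trans _ ik).
rewrite /Fstep; apply: (congr1 (@GRing.opp T)).
by apply: eq_big_nat => i ik; rewrite E.
Qed.

Lemma FrecS N k c :
  Frec N.+1 k c = if k == 1%N then F1 c else Fstep (Frec N) k c.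
Proof. exact: erefl. Qed.

Lemma FrecE N k c : (k <= N)%N -> Frec N k c = Fk k c.
Proof.
rewrite /Fk; have [n] := ubnP k.
elim: n k N c => [|n IH] k N c; first by rewrite ltn0.
rewrite ltnS; case: k => [|k] kn; case: N => [|N] kN.
- exact: erefl.
- by rewrite FrecS /Fstep big_geq // oppr0.
- by rewrite ltn0 in kN.
rewrite !FrecS; case: eqP => _; first exact: erefl.
apply: eq_Fstep => i /andP[_ ik] {}c; rewrite ltnS in ik.
rewrite (IH i N) ?(IH i k) //.
- exact: leq_ltn_trans ik kn.
- exact: leq_ltn_trans ik kn.
- exact: leq_trans ik kN.
Qed.

Lemma Fk1 c : Fk 1 c = F1 c.
Proof. exact: erefl. Qed.

Lemma FkE k c : (1 < k)%N -> Fk k c = Fstep Fk k c.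
Proof.
case: k => [|k]; first by rewrite ltn0.
rewrite ltnS => k0; rewrite {1}/Fk FrecS eqSS eqn0Ngt k0.
apply: eq_Fstep => i /andP[_ ik] {}c; exact: FrecE.
Qed.

(** On a generator of degree [n], F_k takes values in degree [n + k - 1] of the
    [k]-fold tensor power, while (s^-1)^{(x)k} vanishes on words with a factor of
    degree 0.  If [K] and [L] are 1-reduced there is nothing in degree 1, so the
    terms with [2 * k > n + k - 1], i.e. [k >= n], of the sum over all [k >= 1]
    vanish. *)
Definition omega_tilde :
  cobar (chains KL) -> cobar (gtens (chains K) (chains L)) :=
  cobar_ext (fun b : gen (chains KL) =>
    \sum_(1 <= k < (gdeg (val b)).+1) desusp_tens (Fk k (val b))).

End OmegaTilde.

Section Milgram.
Variables B B' : gbasis.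

(** A basis element of degree 0 is the unit 1 if it is the only one, which is the
    case for chains of 1-reduced simplicial sets. *)
Definition milgram_gen (b : gen (gtens B B')) : cobar2 B B' :=
  let: (x, y) := val b in
  if gdeg y == 0%N then tens (desusp << x >>) 1
  else if gdeg x == 0%N then tens 1 (desusp << y >>)
  else 0.

Definition milgram : cobar (gtens B B') -> cobar2 B B' := cobar_ext milgram_gen.

End Milgram.

Definition AW_diagonal (K : sset) :
  cobar (chains K) -> cobar2 (chains K) (chains K) :=
  @milgram _ _ \o @omega_tilde K K \o cobar_map (chain_map (sdiag K)).

(** * Baues's coproduct *)

Section Baues.
Variable K : sset.

(** s^-1 x_s, read as 1 for faces of dimension 1. *)
Definition sface n (x : K n) (s : seq nat) : cobar (chains K) :=
  if size s == 2%N then 1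
  else desusp (cl (act (mon_of (size s).-1 n (nth 0%N s)) x)).

(** With [a 0 = 0], [a m.+1 = n] this is the sum of the [i * (gap i)] over
    [0 <= i <= m], where [gap i] is the number of vertices strictly between [a i]
    and [a i.+1]: the number of pairs of a vertex not in [a] and a smaller vertex
    among [a 1, ..., a m].  The first gap, of [a 1 - 1] vertices, has coefficient
    0: a further summand [a 1 - 1] would give an algebra map that is neither a
    chain map (for [n = 4]) nor equal to [AW_diagonal] (for [n = 3]). *)
Definition baues_exp n m (a : nat -> nat) : nat :=
  ((\sum_(2 <= i < m.+1) i.-1 * (a i - a i.-1 - 1)) + m * (n - a m - 1))%N.

Definition baues_gen (c : gen (chains K)) : cobar2 (chains K) (chains K) :=
  let n := projT1 (val (val c)) in
  let x := projT2 (val (val c)) in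
  \sum_(m < n)
   \sum_(t : m.-tuple 'I_n | path ltn 0%N (map val t))
     let b := 0%N :: rcons (map val t) n in
     let a := nth 0%N b in
     (tens (\prod_(i < m.+1) sface x (index_iota (a i) (a i.+1).+1))
           (sface x b) : cobar2 (chains K) (chains K))
       *~ ksign (baues_exp n m a).

Definition baues : cobar (chains K) -> cobar2 (chains K) (chains K) :=
  cobar_ext baues_gen.

End Baues.

Arguments AW_diagonal : clear implicits.
Arguments baues : clear implicits.

(* Main.v *)
Require Import Defs.
From mathcomp Require Import all_boot.
From HB Require Import structures.
From mathcomp Require Import all_order all_algebra.
From mathcomp Require Import finmap boolp zify.
From mathcomp.multinomials Require Import monalg.

(** Milgram's map kills every word containing a letter [s^-1 (x (x) y)] with
    both factors of positive degree, so on generators the diagonal is the map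
    [tau = sum_k q (s^-1)^k F_k], which satisfies
    [tau = tau_1 - sum (-1)^|a| tau(a) tau(b)], the sum being over the terms
    [a (x) b] of the coproduct of [phi].  Baues's sum makes sense for every pair
    [(x, y)], not only on the diagonal, and we show by induction on the dimension
    that it satisfies the same recursion.

    A term of [phi (x, y)] is a lattice path: [(0,0), ..., (m,m)], then a jump to
    [(m, i)], then a shuffle of [x_{m..i}] with [y_{i..n}].  In Baues's sum a step
    that does not move in [x] has to form a block by itself, and a step that does
    not move in [y] must not.  Hence Baues's sum vanishes on any path in which a
    step of the first kind is followed only by steps of these two kinds, one of
    them of the second kind.  When a path of [phi] is cut in two, both halves
    survive only if the cut is at [(m, n)] and the path is
    [(0,0), ..., (m,m), (m,i), ..., (m,n), ..., (i,n)].  The product of the two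
    halves then consists of the terms of Baues's sum of [(x, y)] whose last block
    of dimension at least 2 is [x_{m..i}]. *)

Set Implicit Arguments.
Unset Strict Implicit.
Unset Printing Implicit Defensive.

Import GRing.Theory.
Local Open Scope ring_scope.

(** * Sums over cuts of a path into blocks *)

Section CutSum.
Variables (R : nzRingType) (bl : nat -> nat -> R) (Y : seq nat -> R).

(* The sum over [0 = v_0 < ... < v_m = p] of [Y (v_0, ..., v_m, s)] times the
   blocks [bl v_i v_(i+1)]: [s] lists the cut points chosen above [p].  The sign
   is the one of Baues's sum after [bl j p] has passed [Y] by the Koszul rule,
   which makes it independent of [m]. *)
Fixpoint cuts m p s : R :=
  if m is m'.+1 then
    \sum_(j < p) (cuts m' j (p :: s) * bl j p) *~ ksign (size s * (p - j.+1))
  else if p == 0%N then Y (0%N :: s) else 0.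

Definition cutsum p s := \sum_(m < p.+1) cuts m p s.

Lemma cuts_eq0 m p s : (p < m)%N -> cuts m p s = 0.
Proof.
elim: m p s => [|m IH] p s //= pm; apply: big1 => j _.
by rewrite IH ?mul0r ?mul0rz //; have := ltn_ord j; lia.
Qed.

Lemma cutsum_widen N p s : (p < N)%N -> cutsum p s = \sum_(m < N) cuts m p s.
Proof.
move=> pN; rewrite /cutsum -!(big_mkord xpredT (fun m => cuts m p s)).
rewrite [RHS](big_cat_nat _ pN) //= [X in _ = _ + X]big_nat_cond.
by rewrite [X in _ = _ + X]big1 ?addr0 // => m; rewrite andbT => /andP[/cuts_eq0->].
Qed.

Lemma cutsum0 s : cutsum 0 s = Y (0%N :: s).
Proof. by rewrite /cutsum big_ord1. Qed.

(** Splits off the last block. The number of blocks can be summed away because the sign in [cuts]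
    does not depend on it. *)
Lemma cutsumE p s : (0 < p)%N -> cutsum p s =
  \sum_(j < p) (cutsum j (p :: s) * bl j p) *~ ksign (size s * (p - j.+1)).
Proof.
move=> p0; rewrite /cutsum big_ord_recl /= eqn0Ngt p0 add0r exchange_big /=.
apply: eq_bigr => j _; rewrite -/(cutsum _ _) (@cutsum_widen p) //.
by rewrite mulr_suml mulrz_suml.
Qed.

End CutSum.

(** Only the length of the accumulated list enters the signs, so [s] and [s'] may differ; this is
    what allows a path to be reparametrized. *)
Lemma eq_cutsum (R : nzRingType) (bl bl' : nat -> nat -> R) (Y Y' : seq nat -> R)
    p s s' :
    size s = size s' ->
    (forall i j, (i < j <= p)%N -> bl i j = bl' i j) ->
    (forall l, path ltn 0%N l -> all (leq^~ p) l ->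
       last 0%N l = p -> Y (0%N :: l ++ s) = Y' (0%N :: l ++ s')) ->
  cutsum bl Y p s = cutsum bl' Y' p s'.
Proof.
elim/ltn_ind: p s s' => p IH s s' ss eb eY.
have [p0|p0] := posnP p.
  by rewrite p0 !cutsum0; apply: (eY [::]); rewrite // p0.
rewrite !cutsumE //; apply: eq_bigr => j _; have jp := ltn_ord j.
rewrite ss; congr (_ * _ *~ _); last by apply: eb; rewrite jp /=.
apply: IH => //=; first by rewrite ss.
  by move=> i k ik; apply: eb; lia.
move=> l l0 lj ll; rewrite -!cat_rcons; apply: eY.
- by rewrite rcons_path l0 ll.
- rewrite all_rcons leqnn; apply: sub_all lj => k /=; lia.
- by rewrite last_rcons.
Qed.

Lemma cutsum_eq0 (R : nzRingType) (bl : nat -> nat -> R) (Y : seq nat -> R) p s :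
  (forall l, last 0%N l = p -> Y (0%N :: l ++ s) = 0) -> cutsum bl Y p s = 0.
Proof.
move=> Y0; have -> : cutsum bl Y p s = cutsum bl (fun=> 0) p s.
  by apply: eq_cutsum => // l _ _; apply: Y0.
have cuts0 m q t : cuts bl (fun=> 0) m q t = 0.
  elim: m q t => [|m IH] q t /=; first by rewrite if_same.
  by apply: big1 => j _; rewrite IH mul0r mul0rz.
by apply: big1 => m _.
Qed.

Lemma iota_cat_cons i n s : iota i n ++ (i + n)%N :: s = iota i n.+1 ++ s.
Proof. by rewrite -[n.+1]addn1 iotaD -catA. Qed.

(** * Evaluation and vanishing of cut sums along a path *)

Section Paths.
Variables (R : nzRingType) (bl : nat -> nat -> R) (Y : seq nat -> R).
Hypothesis bl1 : forall j, bl j j.+1 = 1.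

(** The terms are sorted by their last block [[m, i]] of length at least 2: all points above [i] are
    then cut points, and the blocks of length 1 between them contribute 1 with trivial sign. The
    first summand has no long block. *)
Lemma cutsum_last_block p s : cutsum bl Y p s = Y (iota 0 p.+1 ++ s) +
  \sum_(i < p.+1) \sum_(m < i.-1)
     (cutsum bl Y m (iota i (p.+1 - i) ++ s) * bl m i)
       *~ ksign ((size s + (p - i)) * (i - m.+1))%N.
Proof.
elim: p s => [|p IH] s.
  by rewrite cutsum0 big_ord1 big_ord0 addr0.
rewrite cutsumE // big_ord_recr /= bl1 mulr1 subnn muln0 mulr1z IH.
rewrite addrC -addrA; congr (_ + _).
  by congr Y; exact: (iota_cat_cons 0 p.+1).
rewrite [RHS]big_ord_recr /=; congr (_ + _); apply: eq_bigr => i _; last first.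
  by rewrite subnn addn0 subSnn.
have ip := ltn_ord i; apply: eq_bigr => m _; congr (_ * _ *~ ksign _).
  congr cutsum; rewrite [(p.+2 - i)%N]subSn ?(ltnW ip) // -iota_cat_cons.
  by congr (_ ++ _ :: _); lia.
by congr (_ * _)%N; lia.
Qed.

(** [dx k] stands for a step from [k] to [k.+1] that does not move in the first coordinate, and [b]
    for the second coordinate. Blocks of length 1 and lists of two points are exempt below because a
    desuspended edge is read as 1, even if degenerate. *)
Variables (dx : pred nat) (b : nat -> nat).

Hypothesis bl0 : forall j k p, (j <= k < p)%N -> (j.+1 < p)%N -> dx k -> bl j p = 0.
Hypothesis Y0 : forall l, size l != 2 -> ~~ sorted (fun i j => b i != b j) l -> Y l = 0.

(** The last premise ensures that the list has a third point, so that the exemption in [Y0] does not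
    apply. *)
Lemma Y_adjacent l u v s : b u = b v -> last 0%N l = u ->
  (0 < u)%N || (s != [::]) -> Y (0%N :: l ++ v :: s) = 0.
Proof.
move=> uv lu us; apply: Y0.
  by case: l lu => [|a [|a' l]] //= lu; case: s us => //=; rewrite -lu.
by rewrite /= cat_path /= lu uv eqxx andbF.
Qed.

(** The step [u] either lies in a long block, which [bl0] kills, or is a block by itself; then [u]
    and [u.+1] are adjacent in the list given to [Y]. *)
Lemma cutsum_degenerate u p s : (u < p)%N -> dx u -> b u = b u.+1 ->
  (1 < p)%N || (s != [::]) -> cutsum bl Y p s = 0.
Proof.
move=> + du bu; elim/ltn_ind: p s => p IH s up ps.
rewrite cutsumE; last by lia.
apply: big1 => j _; have jp := ltn_ord j; have [uj|ju] := ltnP u j.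
  by rewrite IH ?orbT // mul0r mul0rz.
have [jp1|pj] := ltnP j.+1 p; first by rewrite (@bl0 _ u) ?ju // mulr0 mul0rz.
have -> : j = u :> nat by lia.
rewrite cutsum_eq0 ?mul0r ?mul0rz // => l lu; apply: Y_adjacent lu _.
  by rewrite bu; congr b; lia.
by case/orP: ps => [p1|->]; [apply/orP; left; lia|rewrite orbT].
Qed.

(** A block that starts before [u] and contains the step [u] also contains [u.-1], hence vanishes;
    so the block of the step [u] starts at [u]. If it is long and contains a step in [dx], it
    vanishes; otherwise [b] agrees at its two ends, which kills [Y]. *)
Lemma cutsum_corner u p s : (u < p)%N -> (0 < u -> dx u.-1)%N -> b u = b u.+1 ->
  (forall k, u <= k < p -> ~~ dx k -> b k = b k.+1)%N ->
  (s != [::]) \/ (1 < p)%N /\ (exists2 k, (k < p)%N & dx k) ->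
  cutsum bl Y p s = 0.
Proof.
move=> + du bu; elim/ltn_ind: p s => p IH s up st ps.
rewrite cutsumE; last by lia.
apply: big1 => j _; have jp := ltn_ord j; have [uj|ju] := ltnP u j.
  rewrite IH ?mul0r ?mul0rz //; last by left.
  by move=> k uk; apply: st; lia.
have [ju'|uj] := ltnP j u.
  have du' := du (leq_ltn_trans (leq0n _) ju').
  by rewrite (@bl0 _ u.-1) ?mulr0 ?mul0rz //; lia.
have {uj} ju : j = u :> nat by apply/eqP; rewrite eqn_leq ju uj.
rewrite ju; have [/existsP[k /andP[uk dk]]|] := boolP [exists k : 'I_p, (u <= k)%N && dx k].
  have kp := ltn_ord k.
  have [up1|pu] := ltnP u.+1 p; first by rewrite (@bl0 _ k) ?mulr0 ?mul0rz // uk kp.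
  have ku : k = u :> nat by lia.
  rewrite (@cutsum_eq0 _ _ _ u) ?mul0r ?mul0rz // => l lu; apply: Y_adjacent lu _.
    by rewrite bu; congr b; lia.
  by case: ps => [->|[p1 _]]; [rewrite orbT|apply/orP; left; lia].
rewrite negb_exists => /forallP nd.
have nd' k : (u <= k < p)%N -> ~~ dx k.
  by case/andP=> uk kp; have := nd (Ordinal kp); rewrite /= uk.
have bup k : (u + k <= p)%N -> b u = b (u + k)%N.
  elim: k => [|k IHk] kp; first by rewrite addn0.
  rewrite IHk; last by lia.
  rewrite addnS; apply: st; first by lia.
  by apply: nd'; lia.
rewrite (@cutsum_eq0 _ _ _ u) ?mul0r ?mul0rz // => l lu; apply: Y_adjacent lu _.
  by rewrite (bup (p - u)%N); [congr b; lia|lia].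
case: ps => [->|[_ [k kp dk]]]; first by rewrite orbT.
(* For [u = 0] the list could be the exempt [[:: 0; p]]; the assumed step in [dx] excludes this. *)
rewrite lt0n; case: eqP => //= u0; have uk : (u <= k < p)%N by rewrite u0 kp.
by have := nd' k uk; rewrite dk.
Qed.

Lemma cutsum_corner_exists u p : (1 < p)%N -> (0 < u -> dx u.-1)%N ->
  (forall k, u <= k < p -> ~~ dx k -> b k = b k.+1)%N ->
  (exists2 k, (u <= k < p)%N & b k = b k.+1) ->
  (exists2 k, (k < p)%N & dx k) ->
  cutsum bl Y p [::] = 0.
Proof.
move=> p1 du st ex1 ex2.
have {ex1} exk : exists k, (u <= k < p)%N && (b k == b k.+1).
  by case: ex1 => k kp /eqP bk; exists k; rewrite kp.
(* The first step from [u] on that fixes [b] is a corner: its predecessor changes [b], hence lies in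
   [dx]. For [v = u] this is [du]. *)
case: (ex_minnP exk) => v /andP[/andP[uv vp] /eqP bv] vmin.
apply: (@cutsum_corner v) => //; last by right.
- move=> v0; have [vu|vu] := eqVneq v u; first by rewrite vu in v0 *; exact: du.
  have uv' : (u <= v.-1 < p)%N by lia.
  apply/negPn/negP => /(st _ uv') /eqP bv'.
  by have := vmin v.-1; rewrite uv' bv' => /(_ isT); lia.
- by move=> k kp; apply: st; lia.
Qed.

(** A step in [dx] has to be a block by itself, so all points from [m] on are cut points. *)
Lemma cutsum_tail m p s : (m <= p)%N -> (forall k, (m <= k < p)%N -> dx k) ->
  cutsum bl Y p s = cutsum bl Y m (iota m.+1 (p - m) ++ s).
Proof.
elim: p s => [|p IH] s; first by rewrite leqn0 => /eqP->.
rewrite leq_eqVlt => /predU1P[->|mp dk]; first by rewrite subnn.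
rewrite ltnS in mp; rewrite cutsumE // big_ord_recr /= big1 ?add0r; last first.
  move=> j _; have jp := ltn_ord j; rewrite (@bl0 _ p) ?mulr0 ?mul0rz //; try lia.
  by apply: dk; lia.
rewrite bl1 mulr1 subnn muln0 mulr1z IH //; last by move=> k kp; apply: dk; lia.
rewrite subSn // -iota_cat_cons.
by congr (cutsum _ _ _ (_ ++ _ :: _)); lia.
Qed.

(** An interior cut point would put two adjacent points with equal [b] into a list of at least
    three; the uncut path survives because its list has only two. *)
Lemma cutsum_constant p : (0 < p)%N -> (forall k, (k < p)%N -> b k = b k.+1) ->
  cutsum bl Y p [::] = Y [:: 0; p]%N * bl 0 p.
Proof.
move=> p0 bk; have bp k : (k <= p)%N -> b k = b 0%N.
  elim: k => // k IH kp; rewrite -bk // IH //; exact: ltnW.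
rewrite cutsumE //; case: p p0 bp {bk} => // p _ bp.
rewrite big_ord_recl /= mul0n mulr1z cutsum0 big1 ?addr0 // => j _.
have jp := ltn_ord j.
rewrite cutsum_eq0 ?mul0r ?mul0rz // => l /= ll; apply: Y_adjacent ll _ => //.
by rewrite bp ?bp // /bump; lia.
Qed.

End Paths.

(** * Faces and simplicial operators *)

Lemma cl_degenerate (K : sset) n (x : K n) :
  degenerate (existT _ n x : simplex K) -> cl x = 0.
Proof. by move=> dx; rewrite /cl insubF //; apply/negbTE/negPn/asboolP. Qed.

Lemma clP (K : sset) n (x : K n) :
  cl x = 0 \/ exists2 c : cell K, val c = existT _ n x & cl x = << c >>.
Proof.
rewrite /cl; case: insubP => [c _ cx|_]; [right|by left].
by exists c.
Qed.

(** Operators become functions on [nat], so that composing and shifting them involves no ordinals.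
    For [k > p] the value is the one at 0. *)
Definition mval p n (a : mon p n) (k : nat) : nat := a (inord k).

Lemma mval_ord p n (a : mon p n) (j : 'I_p.+1) : mval a j = a j.
Proof. by rewrite /mval inord_val. Qed.

Lemma mval_le p n (a : mon p n) k : (mval a k <= n)%N.
Proof. by rewrite -ltnS ltn_ord. Qed.

Lemma mval_homo p n (a : mon p n) i j : (i <= j <= p)%N -> (mval a i <= mval a j)%N.
Proof. by move=> ij; apply: monP; rewrite !inordK; lia. Qed.

Lemma mval_of p n h k :
  (forall i, i <= p -> h i <= n)%N ->
  (forall i j, i <= j <= p -> h i <= h j)%N ->
  (k <= p)%N -> mval (mon_of p n h) k = h k.
Proof. by move=> hn hm kp; rewrite /mval mon_ofE // inordK. Qed.

Lemma mval_comp p n q (a : mon p n) (b : mon q p) k :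
  mval (mon_comp a b) k = mval a (mval b k).
Proof. by rewrite /mval /= ffunE inord_val. Qed.

Lemma mon_ext p n (a b : mon p n) :
  (forall k, (k <= p)%N -> mval a k = mval b k) -> a = b.
Proof.
move=> ab; apply/val_inj/ffunP => j; apply: val_inj.
by have := ab j; rewrite !mval_ord; apply; rewrite -ltnS.
Qed.

Lemma mval_sigma n i k : (i <= n)%N -> (k <= n.+1)%N ->
  mval (sigma n i) k = unbump i k.
Proof. by move=> le_in kn; apply: mval_of => // [j|j l]; rewrite /unbump; lia. Qed.

Lemma degenerate_act (K : sset) p n (x : K n) (a : mon p n) k :
  (k < p)%N -> mval a k = mval a k.+1 ->
  degenerate (existT _ p (act a x) : simplex K).
Proof.
case: p a => // p a; rewrite ltnS => kp ak.
(* Since [a] identifies [k] and [k.+1], it factors through [sigma p k]; the other factor is [a]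
   restricted along the injection omitting [k]. *)
pose b := mon_of p p.+1 (bump k).
exists p, (inord k), (act (mon_comp a b) x).
rewrite inordK // -act_comp; congr (existT _ _ (act _ x)); apply: mon_ext => j jp.
rewrite !mval_comp mval_sigma // mval_of; first last.
- by rewrite /unbump; lia.
- by move=> i l; rewrite /bump; lia.
- by move=> i; rewrite /bump; lia.
have [->|jk] := eqVneq j k; last by congr mval; rewrite /bump /unbump; lia.
by rewrite ak; congr mval; rewrite /bump /unbump; lia.
Qed.

(* No monotonicity is required: [mon_of] of a map that is not monotone is
   constant. *)
Lemma mon_of_eq p n h k : (k < p)%N -> h k = h k.+1 ->
  mval (mon_of p n h) k = mval (mon_of p n h) k.+1.
Proof.
move=> kp hk; rewrite /mval /mon_of val_insubd.
case: ifP => _; rewrite !ffunE //; congr inord; rewrite !inordK ?hk //; lia.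
Qed.

Section Faces.
Variables (K : sset) (n : nat) (x : K n).

Lemma sface2 l : size l = 2%N -> sface x l = 1.
Proof. by rewrite /sface => ->. Qed.

Lemma sface_eq0 l : size l != 2%N -> ~~ sorted (fun i j => i != j) l ->
  sface x l = 0.
Proof.
move=> /negbTE l2 ns; rewrite /sface l2.
have [k kl lk] : exists2 k, (k < (size l).-1)%N & nth 0%N l k = nth 0%N l k.+1.
  have : ~~ all (fun k => nth 0%N l k != nth 0%N l k.+1) (iota 0 (size l).-1).
    apply: contra ns => /allP nl; apply/(sortedP 0%N) => k kl.
    by apply: nl; rewrite mem_iota /=; lia.
  case/allPn => k; rewrite mem_iota add0n /= => kl /negPn/eqP lk.
  by exists k.
by rewrite cl_degenerate /desusp ?raddf0 //; apply: (degenerate_act _ kl); apply: mon_of_eq.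
Qed.

Lemma sface_act p (a : mon p n) l :
  (0 < size l)%N -> sorted leq l -> all (leq^~ p) l ->
  sface (act a x) l = sface x (map (mval a) l).
Proof.
move=> l0 sl al; rewrite /sface size_map; case: ifP => // _.
have ls i : (i < size l)%N = (i <= (size l).-1)%N by rewrite -[in RHS]ltnS prednK.
have lp i : (i <= (size l).-1)%N -> (nth 0%N l i <= p)%N.
  by move=> il; apply: (allP al); rewrite mem_nth // ls.
have lm i j : (i <= j <= (size l).-1)%N -> (nth 0%N l i <= nth 0%N l j)%N.
  by case/andP=> ij jl; apply: (sorted_leq_nth leq_trans leqnn) => //; rewrite inE ls //; lia.
rewrite -act_comp; congr (desusp (cl (act _ x))); apply: mon_ext => k kl.
rewrite mval_comp !mval_of //.
- by rewrite (nth_map 0%N) ?ls.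
- by move=> i il; rewrite (nth_map 0%N) ?ls ?mval_le.
- move=> i j ij; rewrite !(nth_map 0%N) ?ls; try lia.
  by apply: mval_homo; rewrite lm // lp //; lia.
Qed.

Lemma sface_iota : n != 1%N -> sface x (iota 0 n.+1) = desusp (cl x).
Proof.
move=> n1; rewrite /sface size_iota eqSS (negbTE n1) /=.
rewrite (_ : mon_of _ _ _ = mon_id n) ?act_id //; apply: mon_ext => k kn.
have ni i : (i <= n)%N -> nth 0%N (iota 0 n.+1) i = i by move=> ?; rewrite nth_iota.
rewrite mval_of // => [|i i_n|i j ij].
- by rewrite [LHS]ni // /mval /= ffunE inordK.
- by rewrite [X in (X <= _)%N]ni.
- by rewrite [X in (X <= _)%N]ni ?[X in (_ <= X)%N]ni //; lia.
Qed.

Lemma sfaceP l : sface x l = 0 \/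
  exists2 w : {fmonom gen (chains K)}, sface x l = << w >> & wdeg w = (size l - 2)%N.
Proof.
rewrite /sface; case: eqP => [->|_].
  by right; exists mone; rewrite ?wdeg1.
case: (clP (act (mon_of (size l).-1 n (nth 0%N l)) x)) => [->|[c vc ->]].
  by left; rewrite /desusp raddf0.
rewrite /desusp lextU /desusp_gen; case: insubP => [g _ vg|_]; [right|by left].
exists (fmu g) => //; rewrite /wdeg fmU big_seq1 vg /= vc /=; lia.
Qed.

End Faces.

Lemma lext_fun0 (B : choiceType) (V : zmodType) (h : B -> V) c :
  (forall b, h b = 0) -> lext h c = 0.
Proof. by move=> h0; rewrite lextE big1 // => b _; rewrite h0 mul0rz. Qed.

Lemma lext_lext (B B' : choiceType) (V : zmodType) (h : B' -> V)
    (g : B -> {malg int[B']}) c :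
  lext h (lext g c) = lext (fun b => lext h (g b)) c.
Proof.
rewrite [lext g c]lextE raddf_sum lextE; apply: eq_bigr => b _.
exact: (raddfMz (lext h)).
Qed.

Lemma lext_lextU (B B' : choiceType) (V : zmodType) (h : B' -> V) (g : B -> B') c :
  lext h (lext (fun b => << g b >>) c) = lext (fun b => h (g b)) c.
Proof. by rewrite lext_lext; apply: eq_lext => b; rewrite lextU. Qed.

Section Tens.
Variables A B : choiceType.

Lemma tensUU (a : A) (b : B) : tens << a >> << b >> = << (a, b) >>.
Proof. by rewrite /tens !lextU. Qed.

Lemma tens0l (y : {malg int[B]}) : tens (0 : {malg int[A]}) y = 0.
Proof. by rewrite /tens raddf0. Qed.

Lemma tens0r (x : {malg int[A]}) : tens x (0 : {malg int[B]}) = 0.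
Proof. by rewrite /tens lext_fun0 // => a; rewrite raddf0. Qed.

End Tens.

(** * Baues's sum of a path *)

(* Locked because conversion between terms of [cobar2] may unfold its product. *)
HB.lock Definition xblock (K L : sset) n (x : K n) (f : nat -> nat) j p :
    cobar2 (chains K) (chains L) :=
  tens (sface x (map f (index_iota j p.+1))) 1.

HB.lock Definition yface (K L : sset) n (y : L n) (g : nat -> nat) l :
    cobar2 (chains K) (chains L) :=
  tens 1 (sface y (map g l)).

(** Baues's sum of the simplex with vertices [(f k, g k)]. It is set to 0 in dimension at most 1,
    where [cutsum] would give 1 for an edge, whereas the diagonal has no such term on 1-reduced
    sets. *)
HB.lock Definition path_sum (K L : sset) n (x : K n) (y : L n) (f g : nat -> nat) p :
    cobar2 (chains K) (chains L) :=
  if (p <= 1)%N then 0 else cutsum (xblock L x f) (yface K y g) p [::].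

Section PathSum.
Variables (K L : sset) (n : nat) (x : K n) (y : L n).
Local Notation CC := (cobar2 (chains K) (chains L)).

Lemma tens11 : tens (1 : cobar (chains K)) (1 : cobar (chains L)) = 1 :> CC.
Proof. exact: tensUU. Qed.

Local Notation xblock := (@xblock K L n x).
Local Notation yface := (@yface K L n y).
Local Notation path_sum := (@path_sum K L n x y).

Lemma xblock1 f j : xblock f j j.+1 = 1.
Proof. by rewrite unlock sface2 ?tens11 // size_map size_iota; lia. Qed.

Lemma yface2 g l : size l = 2%N -> yface g l = 1.
Proof. by move=> l2; rewrite unlock sface2 ?tens11 // size_map. Qed.

Lemma xblock_eq0 f j k p : (j <= k < p)%N -> (j.+1 < p)%N -> f k == f k.+1 ->
  xblock f j p = 0.
Proof.
move=> kp jp /eqP fk; rewrite unlock sface_eq0 ?tens0l //.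
  by rewrite size_map size_iota; lia.
rewrite sorted_map; apply/negP => /(sortedP 0%N) /(_ (k - j)%N).
rewrite /= size_iota !nth_iota; try lia.
by rewrite addnS subnKC ?fk ?eqxx; lia.
Qed.

Lemma yface_eq0 g l : size l != 2%N -> ~~ sorted (fun i j => g i != g j) l ->
  yface g l = 0.
Proof.
by move=> l2 nl; rewrite unlock sface_eq0 ?tens0r ?size_map // sorted_map.
Qed.

Lemma path_sum_degenerate f g p u : (u < p)%N -> f u = f u.+1 -> g u = g u.+1 ->
  path_sum f g p = 0.
Proof.
move=> up fu gu; rewrite path_sum.unlock; case: ifP => // /negbT p1.
apply: (cutsum_degenerate (@xblock_eq0 f) (@yface_eq0 g) up) => //; first exact/eqP.
by rewrite ltnNge p1.
Qed.

(** In the applications [u] is the point where the shuffle starts: just after the jump, or 0, where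
    the first premise is void, for a half-path inside the shuffle. *)
Lemma path_sum_corner f g p u : (0 < u -> f u.-1 = f u)%N ->
  (forall k, u <= k < p -> f k = f k.+1 \/ g k = g k.+1)%N ->
  (exists2 k, (u <= k < p)%N & g k = g k.+1) ->
  (exists2 k, (k < p)%N & f k = f k.+1) ->
  path_sum f g p = 0.
Proof.
move=> fu fg exg exf; rewrite path_sum.unlock; case: ifP => // /negbT p1.
apply: (cutsum_corner_exists (@xblock_eq0 f) (@yface_eq0 g) (u := u)) exg _.
- by rewrite ltnNge p1.
- by move=> u0; rewrite prednK // fu.
- by move=> k kp /negP fk; case: (fg k kp) => // /eqP.
- by case: exf => k kp /eqP; exists k.
Qed.

Lemma eq_path_sum f f' g g' p :
  (forall k, (k <= p)%N -> f k = f' k) -> (forall k, (k <= p)%N -> g k = g' k) ->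
  path_sum f g p = path_sum f' g' p.
Proof.
move=> ff gg; rewrite path_sum.unlock; case: (_ <= 1)%N; first exact: erefl.
apply: eq_cutsum; first by []; [move=> i j ij|move=> l _ lp _].
  rewrite unlock; congr (tens (sface x _) _); apply/eq_in_map => k.
  by rewrite mem_iota => kij; apply: ff; lia.
rewrite cats0 unlock; congr (tens _ (sface y _)); apply/eq_in_map => k.
by rewrite inE => /predU1P[->|kl]; apply: gg => //; apply: (allP lp).
Qed.

End PathSum.

Lemma path_sum_act (K L : sset) n p d (x : K n) (y : L n) (a b : mon p n) f g :
  (forall i j, (i <= j <= d)%N -> (f i <= f j)%N) ->
  (forall i j, (i <= j <= d)%N -> (g i <= g j)%N) ->
  (forall i, (i <= d)%N -> (f i <= p)%N) -> (forall i, (i <= d)%N -> (g i <= p)%N) ->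
  path_sum (act a x) (act b y) f g d =
  path_sum x y (mval a \o f) (mval b \o g) d.
Proof.
move=> fm gm fp gp; rewrite path_sum.unlock; case: (_ <= 1)%N; first exact: erefl.
apply: eq_cutsum; first by []; [move=> i j ij|move=> l l0 ld _].
  rewrite unlock sface_act.
  - by rewrite -map_comp.
  - by rewrite size_map size_iota; lia.
  - rewrite sorted_map; apply/(sortedP 0%N) => k; rewrite size_iota => kij /=.
    by rewrite !nth_iota; try lia; apply: fm; lia.
  - by rewrite all_map; apply/allP => k; rewrite mem_iota => kij; apply: fp; lia.
rewrite !cats0 unlock sface_act //; first by rewrite -map_comp.
- rewrite sorted_map.
  apply: (@sub_in_sorted _ (leq^~ d) leq _ _ (0%N :: l)); first last.
  - exact: (sub_path (@ltnW) l0).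
  - exact: ld.
  by move=> i j /= _ jd ij; apply: gm; rewrite ij.
- by rewrite all_map; apply/allP => k; rewrite inE => /predU1P[->|/(allP ld)]; apply: gp.
Qed.

Definition simplex_sum (K L : sset) d (z : sprod K L d) := path_sum z.1 z.2 id id d.

Lemma simplex_sum_act (K L : sset) n p (x : K n) (y : L n) (a b : mon p n) :
  simplex_sum ((act a x, act b y) : sprod K L p) = path_sum x y (mval a) (mval b) p.
Proof. by rewrite /simplex_sum path_sum_act // => i j /andP[]. Qed.

Lemma mval_front i n k : (i <= n)%N -> (k <= i)%N -> mval (front i n) k = k.
Proof. by move=> le_in ki; apply: mval_of => // [j|j l]; lia. Qed.

Lemma mval_back i n k : (i <= n)%N -> (k <= n - i)%N -> mval (back i n) k = (i + k)%N.
Proof. by move=> le_in ki; apply: mval_of => // [j|j l]; lia. Qed.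

Section FrontBack.
Variables (K L : sset) (n p : nat) (x : K n) (y : L n) (a b : mon p n) (i : nat).
Hypothesis ip : (i <= p)%N.

Lemma simplex_sum_front :
  simplex_sum (act (front i p) ((act a x, act b y) : sprod K L p)) =
  path_sum x y (mval a) (mval b) i.
Proof.
rewrite /= /sprod_act /= -!act_comp simplex_sum_act.
by apply: eq_path_sum => k ki; rewrite mval_comp mval_front.
Qed.

Lemma simplex_sum_back :
  simplex_sum (act (back i p) ((act a x, act b y) : sprod K L p)) =
  path_sum x y (mval a \o addn i) (mval b \o addn i) (p - i).
Proof.
rewrite /= /sprod_act /= -!act_comp simplex_sum_act.
by apply: eq_path_sum => k ki; rewrite mval_comp mval_back.
Qed.

End FrontBack.

(** * The paths in [phi] *)

Section CountBelow.
Variables (N : nat) (A : {set 'I_N}).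

Definition cnt_below k := #|[set a in A | (a < k)%N]|.

Lemma cnt_below0 : cnt_below 0 = 0%N.
Proof. by apply/eqP; rewrite cards_eq0; apply/eqP/setP => a; rewrite !inE andbF. Qed.

Lemma cnt_belowS (a : 'I_N) : cnt_below a.+1 = (cnt_below a + (a \in A))%N.
Proof.
rewrite /cnt_below (cardsD1 a) !inE ltnSn andbT addnC; congr (_ + _)%N.
apply: eq_card => c; rewrite !inE -val_eqE ltnS [(c <= a)%N]leq_eqVlt.
by case: ltngtP; rewrite ?andbF.
Qed.

Lemma cnt_below_homo i j : (i <= j)%N -> (cnt_below i <= cnt_below j)%N.
Proof.
move=> ij; apply/subset_leq_card/subsetP => a; rewrite !inE => /andP[-> /=].
by move/leq_trans; apply.
Qed.

Lemma cnt_below_le k : (cnt_below k <= #|A|)%N.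
Proof. by apply/subset_leq_card/subsetP => a; rewrite inE => /andP[]. Qed.

End CountBelow.

(** The shuffle that makes its first [l] steps in the second coordinate and all others in the first;
    only these survive. *)
Definition topset N l : {set 'I_N} := [set a : 'I_N | (l <= a)%N].

Lemma card_topsetC N l : (l <= N)%N -> #|~: topset N l| = l.
Proof.
move=> lN; rewrite -sum1_card (eq_bigl (fun a : 'I_N => (a < l)%N)); last first.
  by move=> a; rewrite !inE ltnNge.
by rewrite (big_ord_narrow lN) sum1_card card_ord.
Qed.

Lemma card_topset N l : (l <= N)%N -> #|topset N l| = (N - l)%N.
Proof. by move=> lN; have := cardsC (topset N l); rewrite card_topsetC // card_ord; lia. Qed.

Lemma cnt_belowC N (A : {set 'I_N}) k : (k <= N)%N ->
  (cnt_below A k + cnt_below (~: A) k)%N = k.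
Proof.
elim: k => [|k IH] kN; first by rewrite !cnt_below0.
have := IH (ltnW kN); rewrite -[k.+1]/((Ordinal kN).+1) !cnt_belowS inE.
by case: (_ \in A) => /=; lia.
Qed.

Lemma cnt_below_topsetC N l k : (l <= N)%N -> cnt_below (~: topset N l) k = minn l k.
Proof.
move=> lN; rewrite -(@card_topsetC N (minn l k)) ?geq_min ?lN //; apply: eq_card => a.
by rewrite !inE -!ltnNge; lia.
Qed.

Lemma shuffle_inv_topset N l : (l <= N)%N ->
  shuffle_inv (topset N l) = ((N - l) * l)%N.
Proof.
move=> lN; rewrite /shuffle_inv -[in RHS](card_topset lN) -[X in (_ * X)%N](card_topsetC lN).
rewrite -cardsX; apply: eq_card => -[a b]; rewrite !inE /=.
case: (leqP l a) => //= la; case: (leqP l b) => //= bl.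
exact: leq_trans bl la.
Qed.

(* The path [(0,0), ..., (m,m)], [(m,i)], ..., [(i,n)] with [i = m + #|A|] and
   [n = m + N]: after the jump, the steps in [A] are those that move in [x]. *)
Definition pathx m N (A : {set 'I_N}) k :=
  if (k <= m)%N then k else (m + cnt_below A (k - m.+1))%N.

Definition pathy m N (A : {set 'I_N}) k :=
  if (k <= m)%N then k else (m + #|A| + cnt_below (~: A) (k - m.+1))%N.

Definition lift_path (f : nat -> nat) k := if k is k'.+1 then (f k').+1 else 0%N.

Lemma lift_pathx m N (A : {set 'I_N}) : lift_path (pathx m A) =1 pathx m.+1 A.
Proof. by case=> [|k] //=; rewrite /pathx ltnS subSS; case: ifP. Qed.

Lemma lift_pathy m N (A : {set 'I_N}) : lift_path (pathy m A) =1 pathy m.+1 A.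
Proof. by case=> [|k] //=; rewrite /pathy ltnS subSS; case: ifP. Qed.

Lemma mval_prime p n (a : mon p n) k : (k <= p.+1)%N ->
  mval (Defs.prime a) k = lift_path (mval a) k.
Proof.
move=> kp; rewrite mval_of //.
- by case=> // j; rewrite ltnS.
- move=> [|i] [|j] //= ij; rewrite ltnS; apply: mval_homo; lia.
Qed.

Lemma mval_shuffle_front N i (A : {set 'I_N}) k : #|A| = i -> (i <= N)%N -> (k <= N)%N ->
  mval (mon_comp (front i N) (shuffle_mon i A)) k = cnt_below A k.
Proof.
move=> Ai iN kN; rewrite mval_comp mval_front ?mval_le // mval_of //.
- by move=> j _; rewrite -[in X in (_ <= X)%N]Ai; exact: cnt_below_le.
- by move=> j l /andP[jl _]; exact: (cnt_below_homo A jl).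
Qed.

Lemma mval_shuffle_back N i (A : {set 'I_N}) k : #|A| = i -> (i <= N)%N -> (k <= N)%N ->
  mval (mon_comp (back i N) (shuffle_mon (N - i) (~: A))) k =
  (i + cnt_below (~: A) k)%N.
Proof.
move=> Ai iN kN; have cA : #|~: A| = (N - i)%N.
  by have := cardsC A; rewrite card_ord; lia.
rewrite mval_comp mval_back ?mval_le // mval_of //.
- by move=> j _; rewrite -cA; exact: cnt_below_le.
- by move=> j l /andP[jl _]; exact: (cnt_below_homo _ jl).
Qed.

Section PhiSum.
Variable V : zmodType.

Lemma lext_nablaf N (Psi : mon N N * mon N N -> V) :
  lext Psi (nablaf N) = \sum_(i < N.+1) \sum_(A : {set 'I_N} | #|A| == i)
    Psi (mon_comp (front i N) (shuffle_mon i A),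
         mon_comp (back i N) (shuffle_mon (N - i) (~: A))) *~ ksign (shuffle_inv A).
Proof.
rewrite /nablaf raddf_sum; apply: eq_bigr => i _.
rewrite raddf_sum; apply: eq_bigr => A _.
by rewrite raddfMz /= lextU.
Qed.

(** Unrolls the recursion of [phi_op]: [m] derivations prefix [m] diagonal steps with sign
    [ksign m], and [s_0] creates the jump. [Psi] takes arbitrary functions so that the induction can
    precompose it with [lift_path]. *)
Lemma lext_phi_op n (Psi : (nat -> nat) -> (nat -> nat) -> V) :
  (forall f f' g g', (forall k, (k <= n.+1)%N -> f k = f' k) ->
     (forall k, (k <= n.+1)%N -> g k = g' k) -> Psi f g = Psi f' g') ->
  lext (fun ab : mon n.+1 n * mon n.+1 n => Psi (mval ab.1) (mval ab.2)) (phi_op n) =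
  \sum_(m < n) \sum_(i < (n - m).+1) \sum_(A : {set 'I_(n - m)} | #|A| == i)
    Psi (pathx m A) (pathy m A) *~ (ksign m * ksign (shuffle_inv A)).
Proof.
elim: n Psi => [|n IH] Psi ePsi; first by rewrite big_ord0 raddf0.
rewrite /= raddfB /= big_ord_recl; congr (_ + _).
  rewrite /comp_s0 /prime_op !lext_lextU.
  have -> : (n.+1 - ord0 (n' := n) = n.+1)%N by [].
  rewrite lext_nablaf; apply: eq_bigr => i _; apply: eq_bigr => A /eqP Ai.
  have iN : (i <= n.+1)%N by rewrite -ltnS.
  rewrite mul1r; congr (_ *~ _); apply: ePsi => -[|k] kn /=.
  - by rewrite mval_comp mval_prime ?mval_sigma.
  - rewrite mval_comp mval_prime // mval_sigma //=; last by rewrite ltnS mval_le.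
    by rewrite mval_shuffle_front // /pathx /unbump /= subn1 add0n subn1.
  - by rewrite mval_comp mval_prime ?mval_sigma.
  - rewrite mval_comp mval_prime // mval_sigma //=; last by rewrite ltnS mval_le.
    by rewrite mval_shuffle_back // /pathy /unbump /= Ai subn1 add0n subn1.
rewrite /prime_op lext_lextU.
rewrite (eq_lext (g := fun ab : mon n.+1 n * mon n.+1 n =>
  Psi (lift_path (mval ab.1)) (lift_path (mval ab.2)))); last first.
  by move=> ab; apply: ePsi => k kn; rewrite mval_prime.
rewrite (IH (fun f g => Psi (lift_path f) (lift_path g))); last first.
  move=> f f' g g' ff gg; apply: ePsi => -[|k] kn //=; first by rewrite ff.
  by rewrite gg.
rewrite -sumrN; apply: eq_bigr => m _; rewrite -sumrN; apply: eq_bigr => i _.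
rewrite -sumrN; apply: eq_bigr => A _.
rewrite -mulrNz -mulNr; congr (_ *~ _).
  by apply: ePsi => k _; [exact: lift_pathx|exact: lift_pathy].
by congr (_ * _); rewrite /ksign exprS mulN1r.
Qed.

End PhiSum.

(** * Cutting a path of [phi] in two *)

Section ShufflePaths.
Variables (K L : sset) (n : nat) (x : K n) (y : L n) (m N : nat).
Local Notation xblock := (@xblock K L n x).
Local Notation yface := (@yface K L n y).
Hypotheses (mN : (m + N)%N = n) (N0 : (0 < N)%N).

Section Subset.
Variable A : {set 'I_N}.
Local Notation f := (pathx m A).
Local Notation g := (pathy m A).

Lemma pathx_diag k : (k <= m)%N -> f k = k.
Proof. by rewrite /pathx => ->. Qed.

Lemma pathy_diag k : (k <= m)%N -> g k = k.
Proof. by rewrite /pathy => ->. Qed.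

Lemma pathx_jump : f m.+1 = m.
Proof. by rewrite /pathx ltnn subnn cnt_below0 addn0. Qed.

Lemma pathxE k : f (m.+1 + k) = (m + cnt_below A k)%N.
Proof. by rewrite /pathx leqNgt ltn_addr // addKn. Qed.

Lemma pathyE k : g (m.+1 + k) = (m + #|A| + cnt_below (~: A) k)%N.
Proof. by rewrite /pathy leqNgt ltn_addr // addKn. Qed.

Lemma pathxS (a : 'I_N) : f (m.+1 + a).+1 = (f (m.+1 + a) + (a \in A))%N.
Proof. by rewrite -addnS !pathxE cnt_belowS addnA. Qed.

Lemma pathyS (a : 'I_N) : g (m.+1 + a).+1 = (g (m.+1 + a) + (a \notin A))%N.
Proof. by rewrite -addnS !pathyE cnt_belowS inE addnA. Qed.

Lemma path_steps k : (m < k < n.+1)%N -> f k = f k.+1 \/ g k = g k.+1.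
Proof.
move=> kn; have kN : (k - m.+1 < N)%N by lia.
rewrite (_ : k = m.+1 + Ordinal kN)%N; last by rewrite /=; lia.
by rewrite pathxS pathyS; case: (_ \in A); rewrite addn0; [right|left].
Qed.

Definition split_term j : cobar2 (chains K) (chains L) :=
  path_sum x y f g j * path_sum x y (f \o addn j) (g \o addn j) (n.+1 - j).

(** The excluded case is the cut at [(m, n)] of a path whose shuffle moves only in the second
    coordinate before the cut and only in the first after it. *)
Lemma split_term_eq0 j : (j <= n.+1)%N ->
  ~~ ((m < j)%N && (A == topset N (j - m.+1))) -> split_term j = 0.
Proof.
rewrite /split_term => jn nt.
(* If no step moves in the first coordinate, the jump leads from [(m, m)] to itself, and the half
   containing it is degenerate. *)
have [A0|/set0Pn[a aA]] := eqVneq A set0.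
  have fm : f m = f m.+1 by rewrite pathx_diag // pathx_jump.
  have gm : g m = g m.+1.
    rewrite pathy_diag // -[in RHS](addn0 m.+1) pathyE cnt_below0 A0 cards0; lia.
  have [jm|mj] := leqP j m.
    rewrite (@path_sum_degenerate _ _ _ _ _ (f \o addn j) _ _ (m - j)) ?mulr0 //=.
    - lia.
    - by rewrite addnS !subnKC.
    - by rewrite addnS !subnKC.
  by rewrite (@path_sum_degenerate _ _ _ _ _ f _ _ m) ?mul0r.
have aN := ltn_ord a.
have ga : g (m.+1 + a) = g (m.+1 + a).+1 by rewrite pathyS aA addn0.
(* For a cut before the jump, the second half contains the jump and later the step [a]. *)
have [jm|mj] := leqP j m.
  rewrite (@path_sum_corner _ _ _ _ _ (f \o addn j) _ _ (m.+1 - j)) ?mulr0 //=.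
  - by rewrite subSn //= => _; rewrite addnS subnKC // pathx_diag // pathx_jump.
  - by move=> k kn; rewrite !addnS; apply: path_steps; lia.
  - exists (m.+1 + a - j)%N; first by lia.
    by rewrite addnS !subnKC //; lia.
  - exists (m - j)%N; first by lia.
    by rewrite addnS !subnKC // pathx_diag // pathx_jump.
rewrite mj /= in nt.
(* Here the first half contains the jump and a later step [c] that fixes the second coordinate. *)
have [/existsP[c /andP[cA cj]]|] := boolP [exists c in A, (m.+1 + c < j)%N].
  rewrite (@path_sum_corner _ _ _ _ _ f _ _ m.+1) ?mul0r //=.
  - by rewrite pathx_diag // pathx_jump.
  - by move=> k kn; apply: path_steps; lia.
  - exists (m.+1 + c)%N; first by rewrite cj leq_addr.
    by rewrite pathyS cA addn0.
  - by exists m => //; rewrite pathx_diag // pathx_jump.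
rewrite negb_exists_in => /forall_inP Aj.
(* All of [A] comes after the cut. As [A] is not the whole top set, some step outside [A] does too,
   and the second half mixes both kinds. *)
have [c cA cj] : exists2 c, c \notin A & (j <= m.+1 + c)%N.
  apply: contraNP nt => nc; apply/eqP/setP => c; rewrite !inE.
  have [cA|cA] := boolP (c \in A); apply/esym.
    by have := Aj c cA; rewrite -leqNgt; lia.
  by apply/negP => jc; apply: nc; exists c => //; lia.
have cN := ltn_ord c; have := Aj a aA; rewrite -leqNgt => ja.
rewrite (@path_sum_corner _ _ _ _ _ (f \o addn j) _ _ 0) ?mulr0 //=.
- by move=> k kn; rewrite !addnS; apply: path_steps; lia.
- exists (m.+1 + a - j)%N; first by lia.
  by rewrite addnS !subnKC.
- exists (m.+1 + c - j)%N; first by lia.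
  by rewrite addnS !subnKC // pathxS (negbTE cA) addn0.
Qed.

End Subset.

(** The two inequalities say that both halves have length at least 2, below which [path_sum] is
    0. *)
Lemma split_term_top l : (l <= N)%N ->
  split_term (topset N l) (m.+1 + l) =
  if (0 < m + l)%N && (1 < N - l)%N then
    cutsum (xblock id) (yface id) m (iota (n - l) l.+1) * xblock id m (n - l)
  else 0.
Proof.
move=> lN; rewrite /split_term path_sum.unlock leqNgt addSn ltnS.
case: (0 < m + l)%N; last by rewrite mul0r.
rewrite (_ : n.+1 - (m + l).+1 = N - l)%N ?[(N - l <= 1)%N]leqNgt; last by lia.
have [Nl|_] := ltnP 1 (N - l)%N; last by rewrite mulr0.
rewrite [(_ && _)%N]andTb; congr (_ * _).
  (* The jump and the first [l] shuffle steps fix the first coordinate, so each is a block by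
     itself; the points after the jump have second coordinates [n - l, ..., n]. *)
  rewrite (@cutsum_tail _ _ _ (xblock1 L x _) _ (@xblock_eq0 _ L _ x _) m);
    [|by rewrite -addnS leq_addr|].
    rewrite cats0 -addnS addKn; apply: eq_cutsum; first by rewrite !size_iota.
      move=> i j ij; rewrite unlock; congr (tens (sface x _) _); apply/eq_in_map => k.
      by rewrite mem_iota => kij; rewrite pathx_diag //; lia.
    move=> w _ wm _; rewrite unlock; congr (tens _ (sface y _)).
    rewrite -!cat_cons !map_cat; congr (_ ++ _).
      apply/eq_in_map => k; rewrite inE => /predU1P[->|/(allP wm) km]; exact: pathy_diag.
    rewrite map_id -[m.+1]addn0 iotaDl -[(n - l)%N]addn0 iotaDl -map_comp.
    apply/eq_in_map => k; rewrite mem_iota ltnS => /= kl.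
    by rewrite pathyE card_topset // cnt_below_topsetC; lia.
  move=> k; have [->|km] := eqVneq k m; first by rewrite pathx_diag // pathx_jump.
  move=> kl; have kN : (k - m.+1 < N)%N by lia.
  rewrite (_ : k = m.+1 + Ordinal kN)%N; last by rewrite /=; lia.
  by rewrite pathxS inE /= leqNgt (_ : k - m.+1 < l)%N ?addn0 //; lia.
(* On the second half the second coordinate is constantly [n], so only the uncut block [x_{m..n-l}]
   remains. *)
rewrite (cutsum_constant _ (@yface_eq0 K _ _ y _)) ?yface2 ?mul1r //; last first.
- move=> k kl; have kN : (l + k < N)%N by lia.
  rewrite /= -!addSn -!addnA addnS (_ : l + k = Ordinal kN)%N // addnS pathyS inE /=.
  by rewrite leq_addr addn0.
- by lia.
rewrite unlock; congr (tens (sface x _) _).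
rewrite map_id /index_iota subn0 -[m in RHS]addn0 iotaDl.
rewrite (_ : (n - l).+1 - (m + 0) = (N - l).+1)%N; last by lia.
apply/eq_in_map => k; rewrite mem_iota ltnS => /= kl.
rewrite -addSn -addnA pathxE; congr (_ + _)%N.
by have := @cnt_belowC N (topset N l) (l + k); rewrite cnt_below_topsetC; lia.
Qed.

End ShufflePaths.

Lemma ksign_odd a b : odd a = odd b -> ksign a = ksign b.
Proof. by move=> ab; rewrite /ksign -signr_odd ab signr_odd. Qed.

Lemma ksignS a : ksign a.+1 = - ksign a.
Proof. by rewrite /ksign exprS mulN1r. Qed.

Lemma sum_triangle (V : zmodType) n (F : nat -> nat -> V) :
  \sum_(i < n.+1) \sum_(m < i.-1) F m i =
  \sum_(m < n) \sum_(i < (n - m).+1) if (1 < i)%N then F m (m + i)%N else 0.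
Proof.
pose G m i := if (m.+1 < i)%N then F m i else 0.
transitivity (\sum_(i < n.+1) \sum_(m < n) G m i).
  apply: eq_bigr => i _; have i_n : (i.-1 <= n)%N by have := ltn_ord i; lia.
  rewrite (big_ord_widen _ (fun m => F m i) i_n) big_mkcond; apply: eq_bigr => m _.
  by rewrite /G; congr (if _ then _ else _); lia.
rewrite exchange_big; apply: eq_bigr => m _; have mn := ltn_ord m.
rewrite -(big_mkord xpredT (G m)) (@big_cat_nat _ _ _ m) /=; [|by []|by lia].
rewrite big_nat_cond big1 ?add0r; last first.
  by move=> i im; rewrite /G ifF //; lia.
rewrite -{1}[val m]add0n big_addn big_mkord (_ : n.+1 - m = (n - m).+1)%N; last by lia.
by apply: eq_bigr => i _; rewrite /G addnC -addn1 ltn_add2l.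
Qed.

(** * The recursion satisfied by Baues's sum *)

Section TwistedSquare.
Variables (K L : sset) (n : nat) (x : K n) (y : L n).
Local Notation xblock := (@xblock K L n x).
Local Notation yface := (@yface K L n y).

(** The contribution of one term of [phi] to the sum of [(-1)^|a| tau(a) tau(b)]; [j] is the degree
    of the front face. *)
Definition split_sum f g := \sum_(j < n.+2)
  (path_sum x y f g j * path_sum x y (f \o addn j) (g \o addn j) (n.+1 - j))
    *~ ksign j.

Lemma eq_split_sum f f' g g' :
  (forall k, (k <= n.+1)%N -> f k = f' k) -> (forall k, (k <= n.+1)%N -> g k = g' k) ->
  split_sum f g = split_sum f' g'.
Proof.
move=> ff gg; apply: eq_bigr => j _; have jn := ltn_ord j.
rewrite (@eq_path_sum _ _ _ x y f f' g g' j).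
- rewrite (@eq_path_sum _ _ _ x y (f \o addn j) (f' \o addn j)
    (g \o addn j) (g' \o addn j) (n.+1 - j)); first exact: erefl.
  + by move=> k kj; apply: ff; lia.
  + by move=> k kj; apply: gg; lia.
- by move=> k kj; apply: ff; lia.
- by move=> k kj; apply: gg; lia.
Qed.

(** At most one cut survives, and [#|A|] determines it because [topset N l] has [N - l] elements. *)
Lemma split_sum_path m N (A : {set 'I_N}) : (m + N)%N = n -> (0 < N)%N ->
  split_sum (pathx m A) (pathy m A) =
  if A == topset N (N - #|A|) then
    split_term x y m A (m.+1 + (N - #|A|)) *~ ksign (m.+1 + (N - #|A|))
  else 0.
Proof.
move=> mN N0.
have nz j : (j < n.+2)%N -> split_term x y m A j <> 0 ->
    A == topset N (N - #|A|) /\ j = (m.+1 + (N - #|A|))%N.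
  rewrite ltnS => jn nz; have [|] := boolP ((m < j)%N && (A == topset N (j - m.+1))).
    case/andP=> mj /eqP AE; have := card_topset (_ : j - m.+1 <= N)%N.
    rewrite -AE => -> //; last by lia.
    rewrite (_ : N - (N - (j - m.+1)) = j - m.+1)%N; last by lia.
    by rewrite -AE; split => //; lia.
  by move/(split_term_eq0 x y mN N0 jn)/nz.
have jn : (m.+1 + (N - #|A|) < n.+2)%N by lia.
rewrite /split_sum (bigD1 (Ordinal jn)) //= big1 ?addr0; last first.
  move=> j jj0; have [z|nz'] := eqVneq (split_term x y m A j) 0.
    by move: z; rewrite /split_term => ->; rewrite mul0rz.
  have [_ je] := nz j (ltn_ord j) (elimN eqP nz').
  by case/eqP: jj0; apply: val_inj.
case: ifP => // An; have [z|nz'] := eqVneq (split_term x y m A (m.+1 + (N - #|A|))) 0.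
  by move: z; rewrite /split_term => ->; rewrite mul0rz.
by have [] := nz _ jn (elimN eqP nz'); rewrite An.
Qed.

(** A term whose last long block is [[m, m + i]] matches the path of [phi] with [m] diagonal steps
    and shuffle [topset (n - m) (n - m - i)]. The two remaining cases, no long block and the block
    [[0, n]], give the value of [F_1]. *)
Lemma lext_split_sum : (1 < n)%N ->
  path_sum x y id id n = xblock id 0 n + yface id (iota 0 n.+1) -
  lext (fun ab : mon n.+1 n * mon n.+1 n => split_sum (mval ab.1) (mval ab.2)) (phi_op n).
Proof.
move=> n1; rewrite lext_phi_op; last exact: eq_split_sum.
pose F m i := (cutsum (xblock id) (yface id) m (iota i (n.+1 - i)) * xblock id m i)
  *~ ksign ((n - i) * (i - m.+1))%N.
have -> : path_sum x y id id n = yface id (iota 0 n.+1) +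
    \sum_(m < n) \sum_(i < (n - m).+1) if (1 < i)%N then F m (m + i)%N else 0.
  rewrite path_sum.unlock leqNgt n1 cutsum_last_block; last exact: xblock1.
  rewrite cats0 -sum_triangle; apply: (congr1 (+%R _)).
  by apply: eq_bigr => i _; apply: eq_bigr => m _; rewrite cats0 add0n.
(* In the range of the sum, the first guard fails only for [m = 0], [i = n]. *)
pose G m i := if (0 < m + (n - m - i))%N && (1 < i)%N then F m (m + i)%N else 0.
have -> : \sum_(m < n) \sum_(i < (n - m).+1) (if (1 < i)%N then F m (m + i)%N else 0) =
    xblock id 0 n + \sum_(m < n) \sum_(i < (n - m).+1) G m i.
  have -> : xblock id 0 n = F 0%N n.
    rewrite /F subnn mul0n mulr1z subSnn cutsum0 yface2 //.
    by rewrite mul1r.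
  case: (n) n1 @G => // n'; rewrite ltnS => n0 G.
  rewrite big_ord_recl [in RHS]big_ord_recl addrA; congr (_ + _).
  rewrite !subn0 big_ord_recr [in RHS]big_ord_recr /=.
  have -> : G 0%N n'.+1 = 0 by rewrite /G subn0 subnn.
  rewrite addr0 ltnS n0 add0n addrC; congr (_ + _).
  apply: eq_bigr => i _; rewrite /G; congr (if _ then _ else _).
  by have := ltn_ord i; lia.
rewrite addrCA -[RHS]addrA; congr (_ + (_ + _)); rewrite -sumrN; apply: eq_bigr => m _.
rewrite -sumrN; apply: eq_bigr => i _.
have mn := ltn_ord m; have i_nm : (i <= n - m)%N by rewrite -ltnS.
have mN : (m + (n - m))%N = n by lia.
have ll : (n - m - i <= n - m)%N by exact: leq_subr.
have ci : #|topset (n - m) (n - m - i)| = i by rewrite card_topset // subKn.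
rewrite (bigD1 (topset (n - m) (n - m - i))) /=; last by rewrite ci.
rewrite big1 ?addr0; last first.
  move=> A /andP[/eqP Ai AT]; rewrite split_sum_path //; last by lia.
  by rewrite Ai (negbTE AT) mul0rz.
rewrite split_sum_path //; last by lia.
rewrite ci eqxx split_term_top //; last by lia.
rewrite subKn // /G; case: ifP => [/andP[_ i1]|_]; last by rewrite !mul0rz oppr0.
rewrite (_ : n - (n - m - i) = m + i)%N; last by lia.
rewrite /F (_ : n.+1 - (m + i) = (n - m - i).+1)%N; last by lia.
rewrite -mulrzA -mulrNz; congr (_ *~ _).
(* With [l = n - m - i], the exponents from [phi], the shuffle, the cut and the minus sign add up to
   [m + i * l + (m + 1 + l) + 1], which has the parity of [l * (i - 1)]. *)
rewrite shuffle_inv_topset // subKn // -!ksignD -ksignS; apply: ksign_odd.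
rewrite (_ : n - (m + i) = n - m - i)%N ?subnDA //.
rewrite (_ : m + i - m.+1 = i.-1)%N; last by lia.
have oi : odd i = ~~ odd i.-1 by rewrite -oddS (ltn_predK i1).
rewrite oddS !oddD !oddM oddS oi.
by case: (odd m); case: (odd (n - m - i)); case: (odd i.-1).
Qed.

End TwistedSquare.

(** * The twisting recursion *)

Section Supported.

Definition supported (B : choiceType) (P : B -> Prop) (c : {malg int[B]}) :=
  forall b, b \in msupp c -> P b.

Variables (B : choiceType) (P : B -> Prop).

Lemma supported0 : supported P 0.
Proof. by move=> b; rewrite msupp0 inE. Qed.

Lemma supportedU z b : P b -> supported P << z *g b >>.
Proof. by move=> Pb b' /(fsubsetP msuppU_le); rewrite inE => /eqP ->. Qed.

Lemma supportedD c c' : supported P c -> supported P c' -> supported P (c + c').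
Proof. by move=> Pc Pc' b /(fsubsetP (msuppD_le _ _)); rewrite inE => /orP[/Pc|/Pc']. Qed.

Lemma supportedN c : supported P c -> supported P (- c).
Proof. by move=> Pc b; rewrite msuppN => /Pc. Qed.

Lemma supported_sum (I : eqType) (r : seq I) (Q : pred I) (F : I -> {malg int[B]}) :
  (forall i, i \in r -> Q i -> supported P (F i)) -> supported P (\sum_(i <- r | Q i) F i).
Proof.
move=> PF; rewrite big_seq_cond; apply: (big_ind (supported P)).
- exact: supported0.
- exact: supportedD.
- by move=> i /andP[]; exact: PF.
Qed.

Lemma supportedMz c z : supported P c -> supported P (c *~ z).
Proof.
move=> Pc; have Pn k : supported P (c *+ k).
  elim: k => [|k IH]; first exact: supported0.
  by rewrite mulrS; apply: supportedD.
case: z => k; rewrite ?NegzE ?mulrNz; first exact: Pn.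
by apply: supportedN; exact: Pn.
Qed.

Lemma eq_lext_supported (V : zmodType) (h h' : B -> V) c :
  supported P c -> (forall b, P b -> h b = h' b) -> lext h c = lext h' c.
Proof.
move=> Pc hh; rewrite !lextE; apply: eq_big_seq => b /Pc Pb.
by rewrite hh.
Qed.

Lemma lext_sum (V : zmodType) (I : Type) (r : seq I) (Q : pred I) (h : I -> B -> V) c :
  lext (fun b => \sum_(i <- r | Q i) h i b) c = \sum_(i <- r | Q i) lext (h i) c.
Proof.
rewrite lextE (eq_bigr (fun i => \sum_(b <- msupp c) h i b *~ c@_b)); last first.
  by move=> i _; rewrite lextE.
by rewrite exchange_big; apply: eq_bigr => b _; rewrite mulrz_suml.
Qed.

Lemma lextMz (V : zmodType) (h : B -> V) z c :
  lext (fun b => h b *~ z) c = lext h c *~ z.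
Proof.
by rewrite !lextE mulrz_suml; apply: eq_bigr => b _; rewrite -!mulrzA mulrC.
Qed.

End Supported.

Lemma supported_lext (B B' : choiceType) (P : B -> Prop) (P' : B' -> Prop)
    (h : B -> {malg int[B']}) c :
  supported P c -> (forall b, P b -> supported P' (h b)) -> supported P' (lext h c).
Proof.
move=> Pc Ph; rewrite lextE; apply: supported_sum => b bc _.
by apply: supportedMz; apply: Ph; apply: Pc.
Qed.

Section WordSupport.
Variable B : choiceType.
Implicit Types (P Q S : {fmonom B} -> Prop) (c d : tensalg B).

Lemma supported_mul P Q S c d : (forall u v, P u -> Q v -> S (mmul u v)) ->
  supported P c -> supported Q d -> supported S (c * d).
Proof.
move=> PQ Pc Qd; rewrite malgME; apply: supported_sum => u uc _.
by apply: supported_sum => v vd _; apply: supportedU; apply: PQ; [apply: Pc|apply: Qd].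
Qed.

(** Desuspension of words is multiplicative only up to a Koszul sign, which is constant on
    homogeneous factors. *)
Lemma lext_mul (R : nzRingType) (h : {fmonom B} -> R) z P Q c d :
  (forall u v, P u -> Q v -> h (mmul u v) = (h u * h v) *~ z) ->
  supported P c -> supported Q d -> lext h (c * d) = (lext h c * lext h d) *~ z.
Proof.
move=> hM Pc Qd; rewrite malgME raddf_sum [lext h c]lextE mulr_suml mulrz_suml.
apply: eq_big_seq => u /Pc Pu.
rewrite raddf_sum [lext h d]lextE mulr_sumr mulrz_suml.
apply: eq_big_seq => v /Qd Qv.
rewrite /= lextUz hM // mulrzAl mulrzAr -!mulrzA; congr (_ *~ _).
by rewrite mulrC [(c@_u * _)%R]mulrC -?mulrA.
Qed.

End WordSupport.

(** Nonzero products have [i < p] and [j < q], hence [i + j < n], so the range of [k] misses none of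
    them. *)
Lemma cauchy_truncated (R : nzRingType) (f g : nat -> R) p q n :
  (p + q)%N = n.+1 ->
  (forall i, (0 < i)%N -> (p <= i)%N -> f i = 0) ->
  (forall j, (0 < j)%N -> (q <= j)%N -> g j = 0) ->
  \sum_(2 <= k < n.+1) \sum_(1 <= i < k) f i * g (k - i)%N =
  (\sum_(1 <= i < p.+1) f i) * (\sum_(1 <= j < q.+1) g j).
Proof.
move=> pq f0 g0.
transitivity (\sum_(k < n.+1) \sum_(m < k.-1) f m.+1 * g (k - m.+1)%N).
  rewrite -(big_mkord xpredT (fun k => \sum_(m < k.-1) f m.+1 * g (k - m.+1)%N)).
  have inner k : \sum_(1 <= i < k) f i * g (k - i)%N =
      \sum_(m < k.-1) f m.+1 * g (k - m.+1)%N.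
    case: k => [|k]; first by rewrite big_geq // big_ord0.
    by rewrite big_add1 big_mkord.
  rewrite (eq_bigr _ (fun k _ => inner k)).
  case: n {pq} => [|n]; first by rewrite big_geq // big_nat1 big_ord0.
  by rewrite [RHS]big_ltn // [in RHS]big_ltn // !big_ord0 !add0r.
rewrite (sum_triangle n (fun m k => f m.+1 * g (k - m.+1)%N)).
have gsum N : (q <= N)%N -> \sum_(1 <= j < N) g j = \sum_(1 <= j < q.+1) g j.
  move=> qN; have [q0|q0] := posnP q.
    rewrite q0 [RHS]big_geq // big_nat_cond big1 // => j jN.
    by apply: g0; lia.
  rewrite [RHS]big_nat_recr //= (g0 q) // addr0 (big_cat_nat q0 qN) /=.
  by rewrite [X in _ + X]big_nat_cond [X in _ + X]big1 ?addr0 // => j jN; apply: g0; lia.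
have fsum : \sum_(1 <= i < p.+1) f i = \sum_(m < n) f m.+1.
  rewrite big_add1 /= -(big_mkord xpredT (fun m => f m.+1)).
  have [np|pn] := ltnP n p.
    rewrite (_ : p = n.+1); last by lia.
    by rewrite big_nat_recr //= f0 ?addr0 //; lia.
  rewrite [RHS](@big_cat_nat _ _ _ p) //=.
  rewrite [X in _ = _ + X]big_nat_cond [X in _ = _ + X]big1 ?addr0 // => j jN.
  by apply: f0; lia.
rewrite fsum mulr_suml; apply: eq_bigr => m _; have mn := ltn_ord m.
have [mp|pm] := ltnP m.+1 p; last first.
  by rewrite f0 // mul0r big1 // => i _; case: ifP => //; rewrite mul0r.
rewrite -(gsum (n - m)%N); last by lia.
rewrite mulr_sumr big_ord_recl add0r big_add1 big_mkord.
rewrite (_ : n - m = (n - m).-1.+1)%N /=; last by rewrite prednK // subn_gt0.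
rewrite big_ord_recl add0r; apply: eq_bigr => i _ /=.
by congr (_ * g _); rewrite /bump; lia.
Qed.

Lemma cl_nondegenerate (K : sset) n (x : K n) :
  ~ degenerate (existT _ n x : simplex K) ->
  exists2 c : cell K, val c = existT _ n x & cl x = << c >>.
Proof.
move=> nd; rewrite /cl; case: insubP => [c _ cx|]; first by exists c.
by move/negPn/asboolP.
Qed.

Lemma cell_nondegenerate (K : sset) (c : cell K) : ~ degenerate (val c).
Proof. by case: c => u /= /negP nd du; apply/nd/asboolP. Qed.

Lemma gdeg_one_reduced (K : sset) (c : chains K) : one_reduced K -> gdeg c <> 1%N.
Proof.
case=> v [_ vE]; have := @cell_nondegenerate _ c; rewrite /gdeg /=.
case: (val c) => d z /= nd d1; subst d; apply: nd.
by exists 0%N, ord0, v; rewrite (vE z).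
Qed.

Lemma one_reduced_sprod (K L : sset) :
  one_reduced K -> one_reduced L -> one_reduced (sprod K L).
Proof.
move=> [v [v0 v1]] [w [w0 w1]]; exists (v, w); split=> -[a b].
  by rewrite (v0 a) (w0 b).
by rewrite (v1 a) (w1 b).
Qed.

(** Makes [simplex_sum] compatible with normalization, where [cl] kills degenerate simplices. *)
Lemma simplex_sum_degenerate (K L : sset) (u : simplex (sprod K L)) :
  degenerate u -> simplex_sum (projT2 u) = 0.
Proof.
case=> n [i [[x y] ->]] /=; rewrite /sprod_act simplex_sum_act.
have in1 : (i <= n)%N by rewrite -ltnS.
apply: (@path_sum_degenerate _ _ _ _ _ _ _ _ i); first by rewrite ltnS.
  by rewrite !mval_sigma /unbump //; lia.
by rewrite !mval_sigma /unbump //; lia.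
Qed.

Lemma coprodE (K : sset) (c : chain K) : coprod c = lext (fun b => coprod << b >>) c.
Proof.
rewrite /coprod /AW /chain_map lext_lext; apply: eq_lext => b.
by rewrite lextU.
Qed.

Lemma coprod_cell (K : sset) (c : cell K) (d := projT1 (val c)) (z := projT2 (val c)) :
  coprod << c >> =
  \sum_(j < d.+1) tens (cl (act (front j d) z)) (cl (act (back j d) z)).
Proof.
rewrite /coprod /chain_map lextU.
have [|c' vc' ->] := @cl_nondegenerate (sprod K K) d (z, z).
  case=> n [i [[y y'] e]]; apply: (@cell_nondegenerate _ c); exists n, i, y.
  have := congr1 (fun u : simplex (sprod K K) =>
    existT K (projT1 u) (projT2 u).1 : simplex K) e.
  by move=> H; exact: etrans (sigT_eta _) H.
by apply: etrans (lextU _ _) _; rewrite /AW_cell vc'.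
Qed.

Section TwistedCoproduct.
Variables K L : sset.
Local Notation KL := (sprod K L).

Definition cell_sum (c : cell KL) := simplex_sum (projT2 (val c)).

Definition twisted_pair (ab : gtens (chains KL) (chains KL)) :=
  (cell_sum ab.1 * cell_sum ab.2) *~ ksign (gdeg ab.1).

Lemma lext_twisted_pair d e (u : KL d) (v : KL e) :
  lext twisted_pair (tens (cl u) (cl v)) =
  (simplex_sum u * simplex_sum v) *~ ksign d.
Proof.
have [du|nd] := pselect (degenerate (existT _ d u : simplex KL)).
  rewrite cl_degenerate // tens0l raddf0 (simplex_sum_degenerate du).
  by rewrite mul0r mul0rz.
have [dv|nd'] := pselect (degenerate (existT _ e v : simplex KL)).
  rewrite (cl_degenerate dv) tens0r raddf0 (simplex_sum_degenerate dv).
  by rewrite mulr0 mul0rz.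
have [c vc ->] := cl_nondegenerate nd; have [c' vc' ->] := cl_nondegenerate nd'.
by rewrite tensUU lextU /twisted_pair /cell_sum /gdeg /= vc vc'.
Qed.

Definition split_simplex d (w : KL d) := \sum_(j < d.+1)
  (simplex_sum (act (front j d) w) * simplex_sum (act (back j d) w)) *~ ksign j.

(** Wherever the simplex is cut, one of the two faces keeps the repeated vertex. *)
Lemma split_simplex_degenerate (u : simplex KL) :
  degenerate u -> split_simplex (projT2 u) = 0.
Proof.
case=> n [i [[x y] ->]] /=; apply: big1 => j _.
have jn : (j <= n.+1)%N by rewrite -ltnS.
have in1 : (i <= n)%N by rewrite -ltnS.
rewrite simplex_sum_front // simplex_sum_back //.
have s : mval (sigma n i) i = mval (sigma n i) i.+1.
  by rewrite !mval_sigma /unbump //; lia.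
have [ij|ji] := ltnP i j.
  by rewrite (path_sum_degenerate _ _ ij s s) mul0r mul0rz.
rewrite (@path_sum_degenerate _ _ _ x y (mval (sigma n i) \o addn j) _ _ (i - j)).
- by rewrite mulr0 mul0rz.
- by lia.
- by rewrite /= addnS subnKC.
- by rewrite /= addnS subnKC.
Qed.

Lemma lext_coprod_cl d (w : KL d) :
  lext twisted_pair (lext (fun b => coprod << b >>) (cl w)) = split_simplex w.
Proof.
have [dw|nd] := pselect (degenerate (existT _ d w : simplex KL)); last first.
  have [c vc ->] := cl_nondegenerate nd; rewrite lextU coprod_cell vc /=.
  by rewrite raddf_sum; apply: eq_bigr => j _ /=; rewrite lext_twisted_pair.
rewrite cl_degenerate // raddf0 [LHS]raddf0; apply/esym.
exact: (split_simplex_degenerate dw).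
Qed.

Lemma lext_coprod_EZphi (c : cell KL) (n := projT1 (val c)) (z := projT2 (val c)) :
  lext twisted_pair (coprod (EZphi << c >>)) =
  lext (fun ab : mon n.+1 n * mon n.+1 n =>
    split_sum z.1 z.2 (mval ab.1) (mval ab.2)) (phi_op n).
Proof.
rewrite coprodE /EZphi lextU /EZphi_cell !lext_lext; apply: eq_lext => -[a b] /=.
apply: etrans (esym (lext_lext _ _ _)) _; apply: etrans (lext_coprod_cl _) _.
apply: eq_bigr => j _; have jn : (j <= n.+1)%N by rewrite -ltnS.
rewrite (simplex_sum_front _ _ _ _ jn) (simplex_sum_back _ _ _ _ jn); exact: erefl.
Qed.

End TwistedCoproduct.

Lemma supported_cl (K : sset) d (w : K d) : supported (fun b : chains K => gdeg b = d) (cl w).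
Proof.
case: (clP w) => [->|[c vc ->]]; first exact: supported0.
by apply: supportedU; rewrite /gdeg /= vc.
Qed.

Lemma supported_tens_cl (K L : sset) d e (u : K d) (v : L e) :
  supported (fun ab : gtens (chains K) (chains L) => gdeg ab.1 = d /\ gdeg ab.2 = e)
    (tens (cl u) (cl v)).
Proof.
apply: supported_lext (@supported_cl _ _ u) _ => a ad.
apply: supported_lext (@supported_cl _ _ v) _ => b be.
exact: supportedU.
Qed.

Lemma supported_coprod (K : sset) d (w : K d) :
  supported (fun ab : gtens (chains K) (chains K) => gdeg ab.1 + gdeg ab.2 = d)%N
    (coprod (cl w)).
Proof.
rewrite coprodE; apply: supported_lext (@supported_cl _ _ w) _ => c dc.
rewrite coprod_cell; apply: supported_sum => j _ _ ab.
have jd : (j <= projT1 (val c))%N by rewrite -ltnS.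
by move/supported_tens_cl => [-> ->]; rewrite subnKC.
Qed.

Lemma supported_coprod_EZphi (K L : sset) (c : cell (sprod K L)) :
  supported (fun ab : gtens (chains (sprod K L)) (chains (sprod K L)) =>
    gdeg ab.1 + gdeg ab.2 = (gdeg (c : chains _)).+1)%N (coprod (EZphi << c >>)).
Proof.
rewrite coprodE /EZphi lextU /EZphi_cell lext_lext.
apply: (@supported_lext _ _ (fun=> True)) => // ab _.
by rewrite -coprodE; exact: supported_coprod.
Qed.

Definition total_deg (B : gbasis) (w : seq B) : nat := (\sum_(b <- w) gdeg b)%N.

Lemma total_deg_cat (B : gbasis) (u v : seq B) :
  total_deg (u ++ v) = (total_deg u + total_deg v)%N.
Proof. exact: big_cat. Qed.

Lemma desusp_word_cat (B : gbasis) (u v : seq B) :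
  desusp_word (u ++ v) =
  (desusp_word u * desusp_word v) *~ ksign (size v * total_deg u).
Proof.
elim: u => [|b u IH] /=.
  by rewrite /total_deg big_nil muln0 mulr1z mul1r.
rewrite IH /total_deg big_cons mulrzAr mulrA mulrzAl -!mulrzA -!ksignD size_cat.
by congr (_ *~ ksign _); rewrite -/(total_deg u); lia.
Qed.

Lemma desusp_word_eq0 (B : gbasis) (w : seq B) :
  (exists2 b, b \in w & desusp_gen b = 0) -> desusp_word w = 0.
Proof.
elim: w => [[b]|a w IH [b]] //=; rewrite inE => /predU1P[->|bw] b0.
  by rewrite b0 mul0r mul0rz.
by rewrite IH ?mulr0 ?mul0rz //; exists b.
Qed.

Section MilgramWords.
Variables B B' : gbasis.
Local Notation T := (tensalg (gtens B B')).

Definition milgram_word (w : {fmonom gtens B B'}) : cobar2 B B' :=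
  milgram (desusp_word w).

Lemma milgram_desusp_tens (F : T) : milgram (desusp_tens F) = lext milgram_word F.
Proof. exact: lext_lext. Qed.

Lemma milgram_wordM (u v : {fmonom gtens B B'}) :
  milgram_word (mmul u v) =
  (milgram_word u * milgram_word v) *~ ksign (size v * total_deg u).
Proof.
rewrite /milgram_word fmM desusp_word_cat /milgram (raddfMz (cobar_ext (@milgram_gen B B'))).
by rewrite /= (rmorphM (cobar_ext (@milgram_gen B B'))).
Qed.

Lemma milgram_word_fmu (b : gtens B B') :
  milgram_word (fmu b) = milgram (desusp_gen b).
Proof. by rewrite /milgram_word fmU /= mulr1 mul0n mulr1z. Qed.

End MilgramWords.

(** * Milgram's map on the [F_k], and the induction *)

Section Twisting.
Variables K L : sset.
Hypotheses (oneK : one_reduced K) (oneL : one_reduced L).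
Local Notation KL := (sprod K L).
Local Notation T := (tensalg (gtens (chains K) (chains L))).
Local Notation M := (lext (@milgram_word (chains K) (chains L))).

(** [F_k] has degree [k - 1]; the successor avoids truncated subtraction. *)
Definition homogeneous_words (k d : nat) (w : {fmonom gtens (chains K) (chains L)}) :=
  size w = k /\ (total_deg w).+1 = (d + k)%N.

Lemma supported_F1 (c : chains KL) : supported (homogeneous_words 1 (gdeg c)) (F1 c).
Proof.
rewrite /F1 /AW lextU /AW_cell.
apply: (@supported_lext _ _
  (fun ab : gtens (chains K) (chains L) => gdeg ab.1 + gdeg ab.2 = gdeg c)%N).
  apply: supported_sum => i _ _ ab.
  have ic : (i <= gdeg c)%N by rewrite -ltnS.
  by move/supported_tens_cl => [-> ->]; rewrite subnKC.
move=> ab dab; apply: supportedU; rewrite /homogeneous_words fmU /total_deg big_seq1 /=.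
by rewrite dab addn1.
Qed.

Lemma supported_Fk k (c : chains KL) : (0 < k)%N ->
  supported (homogeneous_words k (gdeg c)) (Fk k c).
Proof.
elim/ltn_ind: k c => k IH c k0; have [k1|k1] := leqP k 1.
  have -> : k = 1%N by lia.
  by rewrite Fk1; exact: supported_F1.
rewrite FkE // /Fstep; apply: supportedN; rewrite big_seq.
apply: supported_sum => i _; rewrite mem_index_iota => ik; apply: supportedMz.
rewrite /tens_maps; apply: (supported_lext (@supported_coprod_EZphi K L c)) => ab dab.
apply: supportedMz.
apply: supported_mul (IH i _ ab.1 _) (IH (k - i)%N _ ab.2 _); try lia.
move=> u v [su du] [sv dv]; rewrite /homogeneous_words fmM size_cat total_deg_cat su sv.
by split; lia.
Qed.

(** The [k] letters have total degree at most [2 * k - 1], so one has degree at most 1. By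
    1-reducedness its degree is 0, and its desuspension vanishes. *)
Lemma milgram_Fk_eq0 k (c : chains KL) : (0 < k)%N -> (gdeg c <= k)%N ->
  M (Fk k c) = 0.
Proof.
move=> k0 ck; rewrite (eq_lext_supported (h' := fun=> 0) (@supported_Fk k c k0)).
  by rewrite lext_fun0.
move=> w [sw dw]; rewrite /milgram_word desusp_word_eq0; first exact: raddf0.
have [b bw b1] : exists2 b, b \in (w : seq _) & (gdeg b <= 1)%N.
  apply: contrapT => nb; have : (\sum_(b <- w) 2 <= total_deg w)%N.
    rewrite /total_deg !big_seq; apply: leq_sum => b bw.
    by rewrite ltnNge; apply/negP => b1; apply: nb; exists b.
  by rewrite big_const_seq count_predT iter_addn_0 sw; lia.
exists b => //; rewrite /desusp_gen insubF //; apply/negbTE; rewrite -leqNgt.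
have := gdeg_one_reduced (c := b.1) oneK; have := gdeg_one_reduced (c := b.2) oneL.
by move: b1; rewrite /=; lia.
Qed.

(* The value of [milgram \o omega_tilde] on the generator [s^-1 c]. *)
Definition twisting (c : chains KL) := \sum_(1 <= k < (gdeg c).+1) M (Fk k c).

Lemma milgram_Fk k (c : chains KL) : (1 < k)%N ->
  M (Fk k c) = - \sum_(1 <= i < k)
    lext (fun ab : gtens (chains KL) (chains KL) =>
      (M (Fk i ab.1) * M (Fk (k - i) ab.2)) *~ ksign (gdeg ab.1)) (coprod (EZphi << c >>)).
Proof.
move=> k1; rewrite FkE // /Fstep raddfN raddf_sum; congr (- _).
apply: eq_big_nat => i ik; rewrite raddfMz /tens_maps /= lext_lext -lextMz.
apply: eq_lext => ab; rewrite (raddfMz M) /=.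
rewrite (lext_mul (z := ksign ((k - i) * (gdeg (ab.1 : chains KL) + i).-1)%N)
  _ (@supported_Fk i (ab.1 : chains KL) _)
  (@supported_Fk (k - i) (ab.2 : chains KL) _)); try lia.
  (* The signs of [Fstep] and [milgram_wordM] share [(k - i) * (i - 1)], which cancels;
     [(k - i) * |a|] and [(k - i - 1) * |a|] leave [|a|]. *)
  rewrite -!mulrzA -!ksignD; congr (_ *~ _); apply: ksign_odd.
  rewrite /gdeg /=; move: (projT1 _) => d.
  have [[i' ->] [j jE]] : (exists i', i = i'.+1) /\ (exists j, (k - i = j.+1)%N).
    by split; [exists i.-1|exists (k - i).-1]; lia.
  rewrite jE addnS !(oddD, oddM, oddS, PeanoNat.Nat.pred_succ, succnK).
  by case: (odd j); case: (odd d); case: (odd i').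
move=> u v [su du] [sv dv]; rewrite milgram_wordM sv; congr (_ *~ ksign (_ * _)%N).
by rewrite -du.
Qed.

Lemma milgram_gen_cl d e (u : K d) (v : L e) : (0 < d + e)%N ->
  lext (fun b : gtens (chains K) (chains L) => milgram (desusp_gen b)) (tens (cl u) (cl v)) =
  if e == 0%N then tens (desusp (cl u)) 1
  else if d == 0%N then tens 1 (desusp (cl v)) else 0.
Proof.
move=> de.
(* If one factor is degenerate, the right side could be nonzero only when that factor is a vertex,
   and vertices are never degenerate. *)
have dim0 (X : sset) k (w : X k) : k == 0%N -> ~ degenerate (existT _ k w : simplex X).
  by move=> /eqP k0 [l [i [w']]] /(congr1 (@projT1 _ _)) /=; rewrite k0.
have [du|nd] := pselect (degenerate (existT _ d u : simplex K)).
  rewrite (cl_degenerate du) tens0l raddf0 /desusp raddf0 tens0l.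
  by case: ifP => // _; case: ifP => // /(dim0 _ _ u) /(_ du).
have [dv|nd'] := pselect (degenerate (existT _ e v : simplex L)).
  rewrite (cl_degenerate dv) tens0r raddf0 /desusp raddf0 tens0r.
  by case: ifP => [/(dim0 _ _ v) /(_ dv)//|_]; case: ifP.
have [c vc ->] := cl_nondegenerate nd; have [c' vc' ->] := cl_nondegenerate nd'.
rewrite tensUU lextU /desusp_gen; case: insubP => [g _ vg|]; last first.
  by rewrite /gdeg /= vc vc' /= de.
rewrite /milgram cobar_ext_gen /milgram_gen vg.
by rewrite {1 2}/gdeg /= vc vc'.
Qed.

(** Milgram's map keeps only the two extreme terms of [AW]; all others have two factors of positive
    degree. *)
Lemma milgram_F1 (c : chains KL) (z := projT2 (val c)) : (1 < gdeg c)%N ->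
  M (F1 c) = xblock L z.1 id 0 (gdeg c) + yface K z.2 id (iota 0 (gdeg c).+1).
Proof.
rewrite /F1 lext_lextU /AW lextU /AW_cell /z {z} /gdeg /=.
case: (val c) => n /= [x y] /= n1.
rewrite (eq_lext (g := fun b : gtens (chains K) (chains L) => milgram (desusp_gen b)));
  last by move=> b; exact: milgram_word_fmu.
rewrite raddf_sum.
rewrite (eq_bigr (fun i : 'I_n.+1 =>
  if (n - i == 0)%N then tens (desusp (cl (act (front i n) x))) 1
  else if i == 0%N :> nat then tens 1 (desusp (cl (act (back i n) y))) else 0)); last first.
  move=> i _; apply: (@milgram_gen_cl i (n - i) (act (front i n) x) (act (back i n) y)).
  by have := ltn_ord i; lia.
have frontn : front n n = mon_id n.
  by apply: mon_ext => k kn; rewrite mval_front // /mval /= ffunE inordK.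
rewrite big_ord_recr ifT; last by rewrite /= subnn.
rewrite [front _ _]frontn act_id addrC; congr (_ + _); last first.
  by rewrite xblock.unlock map_id /index_iota subn0 sface_iota //; lia.
case: n n1 x y {frontn} => // n n1 x y; rewrite big_ord_recl big1 ?addr0; last first.
  move=> i _; rewrite ifF; last by rewrite /= /bump; have := ltn_ord i; lia.
  exact: erefl.
have back0 : back 0 n.+1 = mon_id n.+1.
  by apply: mon_ext => k kn; rewrite mval_back ?subn0 // /mval /= ffunE inordK.
apply: etrans (addr0 _) _; rewrite /= [back _ _]back0 act_id.
rewrite yface.unlock map_id -[0%N :: _]/(iota 0 n.+2).
by rewrite sface_iota //; lia.
Qed.

Lemma twisting_simplex_sum (c : chains KL) : twisting c = cell_sum c.
Proof.
have [n] := ubnP (gdeg c); elim: n c => // n IH c; rewrite ltnS => cn.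
have small (a : chains KL) : (gdeg a <= 1)%N -> twisting a = 0 /\ cell_sum a = 0.
  move=> a1; split; last first.
    by rewrite /cell_sum /simplex_sum path_sum.unlock; move: a1; rewrite /gdeg /= => ->.
  have := gdeg_one_reduced (c := a) (one_reduced_sprod oneK oneL).
  by rewrite /twisting => ?; rewrite big_geq //; lia.
have [c1|c1] := leqP (gdeg c) 1; first by have [-> ->] := small c c1.
rewrite /twisting big_ltn; last by lia.
rewrite Fk1 milgram_F1 // /cell_sum /simplex_sum [RHS]lext_split_sum //.
congr (_ + _).
rewrite -lext_coprod_EZphi.
rewrite (eq_big_nat _ _ (F2 := fun k => - \sum_(1 <= i < k)
    lext (fun ab : gtens (chains KL) (chains KL) =>
      (M (Fk i ab.1) * M (Fk (k - i) ab.2)) *~ ksign (gdeg ab.1))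
    (coprod (EZphi << c >>)))); last first.
  by move=> k /andP[k1 _]; exact: milgram_Fk.
rewrite sumrN; congr (- _).
under eq_bigr do rewrite -lext_sum.
rewrite -lext_sum; apply: eq_lext_supported (@supported_coprod_EZphi K L c) _ => ab dab.
under eq_bigr do rewrite -mulrz_suml.
rewrite -mulrz_suml /twisted_pair; apply: (congr1 (fun u => u *~ _)).
rewrite (cauchy_truncated (f := fun i => M (Fk i ab.1)) (g := fun i => M (Fk i ab.2)) dab);
  [|by move=> i; exact: milgram_Fk_eq0|by move=> i; exact: milgram_Fk_eq0].
rewrite -/(twisting ab.1) -/(twisting ab.2).
(* The degrees add up to [gdeg c + 1]; if both are at least 2, both are below [gdeg c] and the
   induction hypothesis applies. *)
have [a1|a1] := leqP (gdeg ab.1) 1; first by have [-> ->] := small _ a1; rewrite !mul0r.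
have [b1|b1] := leqP (gdeg ab.2) 1; first by have [-> ->] := small _ b1; rewrite !mulr0.
by rewrite !IH //; lia.
Qed.

End Twisting.

(** * Comparison with [baues] *)

Lemma malgUU (G : choiceType) (u v : {fmonom G}) :
  << u >> * << v >> = << mmul u v >> :> tensalg G.
Proof. by rewrite malgM_def fgmulUU mulr1. Qed.

Lemma big_rcons_tuple (V : nmodType) n m (P : pred (seq 'I_n)) (F : seq 'I_n -> V) :
  \sum_(t : m.+1.-tuple 'I_n | P t) F t =
  \sum_(a < n) \sum_(t : m.-tuple 'I_n | P (rcons t a)) F (rcons t a).
Proof.
rewrite pair_big_dep (reindex (fun p : 'I_n * m.-tuple 'I_n => rcons_tuple p.2 p.1)) //.
apply: onW_bij; apply: inj_card_bij.
  by move=> [a t] [a' t'] /(congr1 val) /= /rcons_inj [/val_inj -> ->].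
by rewrite card_prod !card_tuple card_ord expnS.
Qed.

Section CutTerms.
Variables (K L : sset) (n : nat) (x : K n) (y : L n).
Local Notation CC := (cobar2 (chains K) (chains L)).
Local Notation xblock := (@xblock K L n x id).
Local Notation yface := (@yface K L n y id).

Definition cut_blocks (b : seq nat) m : cobar (chains K) :=
  \prod_(i < m) sface x (index_iota (nth 0%N b i) (nth 0%N b i.+1).+1).

Lemma cut_blocksP b m :
  cut_blocks b m = 0 \/ exists w : {fmonom gen (chains K)}, cut_blocks b m = << w >>.
Proof.
rewrite /cut_blocks; elim/big_ind: _ => [|A A'|i _].
- by right; exists mone.
- case=> [->|[u ->]]; first by left; rewrite mul0r.
  case=> [->|[v ->]]; first by left; rewrite mulr0.
  by right; exists (mmul u v); rewrite malgUU.
- by case: (sfaceP x (index_iota (nth 0%N b i) (nth 0%N b i.+1).+1)) => [->|[w -> _]];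
    [left|right; exists w].
Qed.

(** The sign arises from moving the block, of degree [p - j.+1], past the face of [y], of degree
    [size l - 2]. *)
Lemma tens_mul_block b m l j p : (0 < size l)%N ->
  (tens (cut_blocks b m) (sface y l) : CC) * xblock j p =
  (tens (cut_blocks b m * sface x (index_iota j p.+1)) (sface y l) : CC)
    *~ ksign ((size l - 2) * (p - j.+1)).
Proof.
move=> l0; rewrite unlock map_id.
case: (sfaceP y l) => [->|[w -> wl]]; first by rewrite !tens0r mul0r mul0rz.
case: (sfaceP x (index_iota j p.+1)) => [->|[v -> vl]].
  by rewrite mulr0 !tens0l mulr0 mul0rz.
case: (cut_blocksP b m) => [->|[u ->]]; first by rewrite mul0r !tens0l mul0r mul0rz.
rewrite malgUU !tensUU; apply: etrans (kmulUU _ _) _; rewrite /kmon /= wl vl mulm1.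
rewrite size_iota; congr (_ *~ ksign (_ * _)%N); lia.
Qed.

Definition cut_sign (b : seq nat) m : nat :=
  (\sum_(i < m) i * (nth 0 b i.+1 - (nth 0 b i).+1))%N.

Definition cut_term (t : seq nat) p s : CC :=
  (tens (cut_blocks (0%N :: rcons t p) (size t).+1) (sface y (0%N :: rcons t p ++ s)) : CC)
    *~ ksign (cut_sign (0%N :: rcons t p) (size t).+1).

Lemma cut_term_nil p s :
  cut_term [::] p s = (yface [:: 0, p & s]%N * xblock 0 p) *~ ksign (size s * (p - 1)).
Proof.
have -> : yface [:: 0, p & s]%N = tens (cut_blocks [::] 0) (sface y [:: 0, p & s]%N).
  by rewrite yface.unlock map_id /cut_blocks big_ord0.
rewrite tens_mul_block // /cut_term /cut_sign /cut_blocks big_ord0 !big_ord1 /= mul0n mul1r.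
rewrite -mulrzA -ksignD; congr (_ *~ _); apply: ksign_odd.
by rewrite !subSS subn0 oddD addbb.
Qed.

Lemma cut_term_rcons t j p s :
  cut_term (rcons t j) p s =
  (cut_term t j (p :: s) * xblock j p) *~ ksign (size s * (p - j.+1)).
Proof.
set b := 0%N :: rcons t j; have sb : size b = (size t).+2 by rewrite /= size_rcons.
have nb i : (i <= (size t).+1)%N -> nth 0%N (rcons b p) i = nth 0%N b i.
  by move=> it; rewrite nth_rcons sb ltnS it.
have nj : nth 0%N (rcons b p) (size t).+1 = j.
  by rewrite nb //= nth_rcons ltnn eqxx.
have np : nth 0%N (rcons b p) (size t).+2 = p by rewrite nth_rcons sb ltnn eqxx.
rewrite /cut_term size_rcons -/b -[0%N :: rcons (rcons t j) p]/(rcons b p).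
have -> : cut_blocks (rcons b p) (size t).+2 =
    cut_blocks b (size t).+1 * sface x (index_iota j p.+1).
  rewrite /cut_blocks big_ord_recr nj np; congr (_ * _).
  by apply: eq_bigr => i _; have := ltn_ord i => it; rewrite !nb ?(ltnW it).
have -> : cut_sign (rcons b p) (size t).+2 =
    (cut_sign b (size t).+1 + (size t).+1 * (p - j.+1))%N.
  rewrite /cut_sign big_ord_recr nj np; congr (_ + _)%N.
  by apply: eq_bigr => i _; have := ltn_ord i => it; rewrite !nb ?(ltnW it).
rewrite -[0%N :: rcons (rcons t j) p ++ s]/(rcons b p ++ s) cat_rcons.
rewrite -[0%N :: rcons t j ++ p :: s]/(b ++ p :: s) mulrzAl tens_mul_block ?size_cat ?sb //.
(* The face passed has degree [size t + size s + 1]; the part [size s] cancels against the sign in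
   [cuts]. *)
rewrite -!mulrzA -!ksignD; congr (_ *~ _); apply: ksign_odd.
rewrite /= addnS !subSS subn0 !(oddD, oddM, oddS).
by case: (odd (cut_sign _ _)); case: (odd (size t)); case: (odd (size s)); case: (odd (p - _)).
Qed.

(** [cuts] chooses the cut points from the largest down, so the tuples grow by [rcons]. *)
Lemma cuts_tuples m p s : (p <= n)%N -> cuts xblock yface m.+1 p s =
  \sum_(t : m.-tuple 'I_n | path ltn 0%N (rcons (map val t) p)) cut_term (map val t) p s.
Proof.
elim: m p s => [|m IH] p s pn.
  case: p pn => [|p] pn.
    by rewrite /= big_ord0 big1 // => t; rewrite tuple0.
  rewrite [LHS]/= big_ord_recl /= big1 ?addr0; last first.
    by move=> i _; rewrite mul0r mul0rz.
  rewrite (big_pred1 [tuple]) ?cut_term_nil //.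
  by move=> t; rewrite tuple0 /= eqxx.
rewrite (big_rcons_tuple m (fun t : seq 'I_n => path ltn 0%N (rcons (map val t) p))
  (fun t : seq 'I_n => cut_term (map val t) p s)).
rewrite -[LHS]/(\sum_(j < p) (cuts xblock yface m.+1 j (p :: s) * xblock j p)
  *~ ksign (size s * (p - j.+1))).
rewrite -(big_ord_narrow (F := fun j : 'I_n => (cuts xblock yface m.+1 j (p :: s) * xblock j p)
  *~ ksign (size s * (p - j.+1))) pn).
rewrite big_mkcond; apply: eq_bigr => a _; case: ifP => ap; last first.
  rewrite big1 // => t; rewrite map_rcons rcons_path last_rcons => /andP[_].
  by rewrite /= ap.
rewrite IH; last by rewrite ltnW.
rewrite mulr_suml mulrz_suml; apply: eq_big => [t|t _].
  by rewrite map_rcons [RHS]rcons_path last_rcons /= ap andbT.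
by rewrite map_rcons cut_term_rcons.
Qed.

End CutTerms.

Lemma baues_gen_path_sum (K : sset) (c : gen (chains K))
    (n := projT1 (val (val c))) (x := projT2 (val (val c))) :
  (1 < n)%N -> baues_gen c = path_sum x x id id n.
Proof.
move=> n1; rewrite path_sum.unlock leqNgt n1 /= /cutsum.
(* [m] interior cut points give [m.+1] blocks; the term without blocks vanishes. *)
rewrite big_ord_recl /= eqn0Ngt (ltnW n1) add0r.
apply: eq_bigr => m _; rewrite -[LHS]/(\sum_(t : m.-tuple 'I_n | path ltn 0%N (map val t)) _).
rewrite [RHS]cuts_tuples //; apply: eq_big => [t|t pt].
  rewrite rcons_path -[LHS]andbT; congr (_ && _); apply/esym.
  case/lastP: (tval t) => [|t' a]; first exact: ltnW n1.
  by rewrite map_rcons last_rcons; apply: ltn_ord.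
rewrite /cut_term cats0 size_map size_tuple; congr (_ *~ ksign _).
rewrite /baues_exp /cut_sign; set a := nth 0%N _.
have an : a m.+1 = n by rewrite /a /= nth_rcons size_map size_tuple ltnn eqxx.
rewrite add0n big_ord_recr /= an -subnDA addn1; congr (_ + _)%N.
rewrite -(big_mkord xpredT (fun i => i * (a i.+1 - (a i).+1))%N).
case: (nat_of_ord m) => [|m']; first by rewrite !big_geq.
(* The gap before the first cut point has coefficient 0 in [cut_sign] and is absent from
   [baues_exp]. *)
rewrite [RHS]big_ltn // mul0n add0n big_add1 /=.
by apply: eq_bigr => i _; rewrite -subnDA addn1.
Qed.

Lemma cobar_word (B : gbasis) (s : seq (gen B)) :
  \prod_(b <- s) << fmu b >> = << FMonom s >> :> cobar B.
Proof.
elim: s => [|b s IH]; first by rewrite big_nil -fmoneE.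
rewrite big_cons IH [LHS]malgUU; congr << _ >>.
by apply: val_inj; rewrite /= [LHS]fmM fmU.
Qed.

Lemma cobar_rmorphism_ext (B : gbasis) (R : nzRingType) (f g : {rmorphism cobar B -> R}) :
  (forall b, f << fmu b >> = g << fmu b >>) -> f =1 g.
Proof.
move=> fg; apply: lext_ext => -[s].
apply: etrans (congr1 f (esym (cobar_word s))) (etrans _ (congr1 g (cobar_word s))).
apply: etrans (rmorph_prod f _ _ _) (etrans _ (esym (rmorph_prod g _ _ _))).
exact: eq_bigr.
Qed.

Lemma degenerate_diag (K : sset) n (x : K n) :
  degenerate (existT _ n (x, x) : simplex (sprod K K)) =
  degenerate (existT _ n x : simplex K).
Proof.
apply/propext; split=> -[k [i [y e]]].
  exists k, i, y.1; exact: (congr1 (fun u : simplex (sprod K K) =>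
    existT K (projT1 u) (projT2 u).1 : simplex K) e).
exists k, i, (y, y); exact: (congr1 (fun u : simplex K =>
  existT (sprod K K) (projT1 u) (projT2 u, projT2 u) : simplex (sprod K K)) e).
Qed.

Lemma AW_diagonal_gen (K : sset) (b : gen (chains K))
    (n := projT1 (val (val b))) (x := projT2 (val (val b))) :
  one_reduced K -> AW_diagonal K << fmu b >> = path_sum x x id id n.
Proof.
move=> hK; rewrite /AW_diagonal /= /cobar_map cobar_ext_gen /chain_map lextU.
have [|c vc] := @cl_nondegenerate (sprod K K) n (x, x).
  by rewrite degenerate_diag -sigT_eta; exact: cell_nondegenerate.
rewrite -/n -/x => ->; rewrite /desusp lextU /desusp_gen.
have dc : gdeg (c : chains _) = n by rewrite /gdeg /= vc.
case: insubP => [g _ vg|]; last by rewrite dc (valP b).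
apply: etrans (congr1 (@milgram _ _) (cobar_ext_gen _ g)) _.
rewrite /milgram [LHS](raddf_sum (cobar_ext (@milgram_gen (chains K) (chains K)))).
rewrite vg; apply: etrans (_ : twisting c = _).
  by apply: eq_bigr => k _; exact: milgram_desusp_tens.
by rewrite twisting_simplex_sum // /cell_sum vc.
Qed.

Theorem mainTheorem4 (K : sset) (hK : one_reduced K) :
  AW_diagonal K =1 baues K.
Proof.
apply: (cobar_rmorphism_ext
  (f := cobar_ext _ \o (cobar_ext _ \o cobar_ext _)) (g := cobar_ext _)).
move=> b; rewrite -[LHS]/(AW_diagonal K << fmu b >>) AW_diagonal_gen //.
apply: etrans _ (esym (cobar_ext_gen _ b)); rewrite baues_gen_path_sum //.
(* Generators have positive degree and 1-reducedness excludes degree 1, which leaves [1 < n]. *)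
have := gdeg_one_reduced (c := val b) hK; have := valP b.
by rewrite /gdeg /=; lia.
Qed.
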